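(* Let $\gamma_1,\gamma_2,\gamma_3,\delta_1,\delta_2,\delta_3,x,y\in\mathbb{C}$, let $\alpha_1,\dots,\alpha_4,\beta_1,\dots,\beta_4$ be positive real numbers, and let $\mu\in\mathbb{C}$ with $\operatorname{Re}\mu>\operatorname{Re}\gamma_2>0$. Then $$D_1\left(\begin{matrix}\gamma_1,\alpha_1,\beta_1;\gamma_2,\alpha_2;\gamma_3,\beta_2;\\ \delta_1,\alpha_3,\beta_3;\delta_2,\alpha_4;\delta_3,\beta_4;\end{matrix}\left|\begin{matrix}x\\ y\end{matrix}\right.\right)=\frac{\Gamma(\mu)}{\Gamma(\gamma_2)\Gamma(\mu-\gamma_2)}\int_0^1\xi^{\gamma_2-1}(1-\xi)^{\mu-\gamma_2-1}D_1\left(\begin{matrix}\gamma_1,\alpha_1,\beta_1;\mu,\alpha_2;\gamma_3,\beta_2;\\ \delta_1,\alpha_3,\beta_3;\delta_2,\alpha_4;\delta_3,\beta_4;\end{matrix}\left|\begin{matrix}x\xi^{\alpha_2}\\ y\end{matrix}\right.\right)d\xi.$$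
   Context: $(\gamma)_\lambda=\Gamma(\gamma+\lambda)/\Gamma(\gamma)$ for $\gamma\in\mathbb{C}$ and real $\lambda\ge0$. For complex $\gamma_i,\delta_i,x,y$ and positive real $\alpha_i,\beta_i$, $$D_1\left(\begin{matrix}\gamma_1,\alpha_1,\beta_1;\gamma_2,\alpha_2;\gamma_3,\beta_2;\\ \delta_1,\alpha_3,\beta_3;\delta_2,\alpha_4;\delta_3,\beta_4;\end{matrix}\left|\begin{matrix}x\\ y\end{matrix}\right.\right)=\sum_{m,n=0}^{\infty}\frac{(\gamma_1)_{\alpha_1 m+\beta_1 n}(\gamma_2)_{\alpha_2 m}(\gamma_3)_{\beta_2 n}}{\Gamma(\delta_1+\alpha_3 m+\beta_3 n)}\frac{x^m}{\Gamma(\delta_2+\alpha_4 m)}\frac{y^n}{\Gamma(\delta_3+\beta_4 n)}.$$ The functions are considered at arguments in the region of absolute convergence of their defining series. *)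

(* Defs.v *)
From mathcomp Require Import all_boot all_order all_algebra.
From mathcomp Require Import all_classical all_reals all_analysis.

Set Implicit Arguments.
Unset Strict Implicit.
Unset Printing Implicit Defensive.

Import Order.TTheory GRing.Theory Num.Theory.
Import numFieldNormedType.Exports.
(* Last, so that Re and Im are the projections of R[i]. *)
From mathcomp Require Import complex.

Local Open Scope classical_set_scope.
Local Open Scope ring_scope.
Local Open Scope complex_scope.

Definition cexp (R : realType) (z : R[i]) : R[i] :=
  (expR (Re z))%:C * (cos (Im z) +i* sin (Im z)).

(* Principal power t^z of a positive real t; only used for 0 < t. *)
Definition cpowR (R : realType) (t : R) (z : R[i]) : R[i] :=
  cexp ((ln t)%:C * z).

Definition cintegrable (R : realType) (D : set R) (f : R -> R[i]) : Prop :=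
  (@lebesgue_measure R).-integrable D (fun t => (Re (f t))%:E) /\
  (@lebesgue_measure R).-integrable D (fun t => (Im (f t))%:E).

Definition cintegral (R : realType) (D : set R) (f : R -> R[i]) : R[i] :=
  (\int[@lebesgue_measure R]_(t in D) Re (f t)) +i*
  (\int[@lebesgue_measure R]_(t in D) Im (f t)).

Definition cseries (R : realType) (u : nat -> R[i]) : R[i] :=
  limn (series (fun k => Re (u k))) +i* limn (series (fun k => Im (u k))).

Definition csummable2 (R : realType) (t : nat -> nat -> R[i]) : Prop :=
  summable [set: nat * nat] (fun p => (Normc.normc (t p.1 p.2))%:E).

(* When csummable2 t holds, the order of summation is irrelevant. *)
Definition cseries2 (R : realType) (t : nat -> nat -> R[i]) : R[i] :=
  cseries (fun m => cseries (fun n => t m n)).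

(* Euler's integral, meaningful for 0 < Re z. *)
Definition Euler_Gamma (R : realType) (z : R[i]) : R[i] :=
  cintegral `]0, +oo[ (fun t => cpowR t (z - 1) * (expR (- t))%:C).

Definition Gamma_shift (R : realType) (z : R[i]) : nat :=
  if 0 < Re z then 0%N else (Num.truncn (- Re z)).+1.

(* The meromorphic Gamma function on the whole plane, continued by
   Gamma z = Gamma (z + n) / (z (z + 1) ... (z + n - 1)), where n is such that
   0 < Re (z + n).  At the poles 0, -1, -2, ... the denominator is 0, hence
   Gamma z = 0 there; so (Gamma z)^-1 = 0 at the poles, which is the value of
   the entire function 1 / Gamma. *)
Definition Gamma (R : realType) (z : R[i]) : R[i] :=
  Euler_Gamma (z + (Gamma_shift z)%:R) /
  \prod_(k < Gamma_shift z) (z + k%:R).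

Definition Gamma_pole (R : realType) (z : R[i]) : bool :=
  (Im z == 0) && (- Re z \is a Num.nat).

(* (g)_l = Gamma (g + l) / Gamma g.  When g is a pole of Gamma and l is a
   natural number, the quotient is read as its limit, the product
   g (g + 1) ... (g + l - 1); when g is a pole and l is not a natural number,
   the quotient is 0, which is again its limit. *)
Definition Pochhammer (R : realType) (g : R[i]) (l : R) : R[i] :=
  if Gamma_pole g && (l \is a Num.nat)
  then \prod_(k < Num.truncn l) (g + k%:R)
  else Gamma (g + l%:C) / Gamma g.

Definition D1_term (R : realType)
    (g1 : R[i]) (a1 b1 : R) (g2 : R[i]) (a2 : R) (g3 : R[i]) (b2 : R)
    (d1 : R[i]) (a3 b3 : R) (d2 : R[i]) (a4 : R) (d3 : R[i]) (b4 : R)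
    (x y : R[i]) (m n : nat) : R[i] :=
  (Pochhammer g1 (a1 * m%:R + b1 * n%:R) * Pochhammer g2 (a2 * m%:R)
     * Pochhammer g3 (b2 * n%:R))
    / Gamma (d1 + (a3 * m%:R + b3 * n%:R)%:C)
  * (x ^+ m / Gamma (d2 + (a4 * m%:R)%:C))
  * (y ^+ n / Gamma (d3 + (b4 * n%:R)%:C)).

Definition D1_summable (R : realType)
    (g1 : R[i]) (a1 b1 : R) (g2 : R[i]) (a2 : R) (g3 : R[i]) (b2 : R)
    (d1 : R[i]) (a3 b3 : R) (d2 : R[i]) (a4 : R) (d3 : R[i]) (b4 : R)
    (x y : R[i]) : Prop :=
  csummable2 (D1_term g1 a1 b1 g2 a2 g3 b2 d1 a3 b3 d2 a4 d3 b4 x y).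

Definition D1 (R : realType)
    (g1 : R[i]) (a1 b1 : R) (g2 : R[i]) (a2 : R) (g3 : R[i]) (b2 : R)
    (d1 : R[i]) (a3 b3 : R) (d2 : R[i]) (a4 : R) (d3 : R[i]) (b4 : R)
    (x y : R[i]) : R[i] :=
  cseries2 (D1_term g1 a1 b1 g2 a2 g3 b2 d1 a3 b3 d2 a4 d3 b4 x y).

(* Main.v *)
Require Import Defs.
From mathcomp Require Import all_boot all_order all_algebra.
From mathcomp Require Import all_classical all_reals all_analysis.
From mathcomp Require Import measurable_realfun ring lra.

Import Order.TTheory GRing.Theory Num.Theory.
Import numFieldNormedType.Exports.
From mathcomp Require Import complex.

Local Open Scope classical_set_scope.
Local Open Scope ring_scope.
Local Open Scope complex_scope.

(** The variable xi enters the m-th term of the right-hand series only through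
    the factor xi^(a2 m).  Hence, with A_m the inner sum over n, the integrand
    is the sum over m of
      A_m xi^(g2 + a2 m - 1) (1 - xi)^(mu - g2 - 1),
    and integrating term by term gives A_m B(g2 + a2 m, mu - g2).  By Euler's
    formula B(p, q) = Gamma (p) Gamma (q) / Gamma (p + q) ([cgamma_mul]), this
    Beta integral is, up to the constant in front of the integral, the ratio of
    (g2)_(a2 m) to (mu)_(a2 m) ([Pochhammer_ratio]), so that the m-th term of
    the left-hand series is recovered.

    Euler's formula comes from Fubini's theorem for the convolution of two
    Gamma kernels, where only translations and dilations of the line are used
    as changes of variable ([integral_affine], [cintegral_affine]).  Dividing
    by Gamma requires that it has no zero with positive real part
    ([cgamma_neq0]); this follows from an explicit lower bound of
    |Gamma (s + i tau)| by Gamma (s) (1 - 2 tau^2 / (s - 1)) ([cgamma_lower]),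
    valid for s > 1 and useful for large s, which is carried to the left by
    Euler's formula with q = 1.

    Term by term integration ([cintegral_series]) requires the sum over m of
    |A_m| B(Re g2 + a2 m, Re (mu - g2)) to be finite, whereas the hypothesis
    controls the sum of |A_m| |B(g2 + a2 m, mu - g2)|.  The two are comparable
    ([beta_le_cbeta]), again by the lower bound of |Gamma|.  The pointwise
    absolute convergence for 0 < xi < 1 follows in the same way from
    xi^l = O(B(Re g2 + l, Re (mu - g2))) ([powR_le_beta]). *)

Local Notation normc := (@Normc.normc _).

(** * Integration on the real line *)

Section affine_change.
Context {R : realType}.
Local Notation mu := (@lebesgue_measure R).
Variables (c d : R).
Hypothesis c0 : 0 < c.

Let phi (t : measurableTypeR R) : measurableTypeR R := c * t + d.

Let mphi : measurable_fun setT phi.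
Proof. by apply: measurable_funD => //; apply: measurable_funM. Qed.

Let image : {measure set (measurableTypeR R) -> \bar R} :=
  measure_function_pushforward__canonical__measure_function_Measure mu mphi.

Let nu : {measure set (measurableTypeR R) -> \bar R} :=
  mscale (NngNum (ltW c0)) image.

Let nuE (A : set (measurableTypeR R)) : measurable A -> mu A = nu A.
Proof.
apply: lebesgue_measure_unique => _ [[a b] _ <-] /=.
rewrite /nu /mscale /= /pushforward.
have -> : phi @^-1` `]a, b] = `](a - d) / c, (b - d) / c]%classic.
  apply/seteqP; split => t /=; rewrite !in_itv/= /phi.
    by rewrite ltr_pdivrMr// ler_pdivlMr// ltrBlDr lerBrDr mulrC.
  by rewrite ltr_pdivrMr// ler_pdivlMr// ltrBlDr lerBrDr mulrC.
rewrite !lebesgue_measure_itv/= !lte_fin.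
rewrite ltr_pM2r ?invr_gt0// ltrD2r; case: ifP => _; last by rewrite mule0.
by rewrite -!EFinD -EFinM; congr EFin; field; rewrite gt_eqF.
Qed.

(** The image of the Lebesgue measure under t |-> c t + d, multiplied by c,
    gives every interval its length, so it is the Lebesgue measure. *)
Lemma ge0_integral_affine (f : R -> \bar R) : measurable_fun setT f ->
  (forall t, 0 <= f t)%E ->
  (\int[mu]_t f t = c%:E * \int[mu]_t f (c * t + d)%R)%E.
Proof.
move=> mf f0; rewrite (@eq_measure_integral _ _ _ _ nu)//; last first.
  by move=> A mA _; exact: nuE.
rewrite ge0_integral_mscale//=; congr (_ * _)%E.
by rewrite (ge0_integral_pushforward mphi).
Qed.

End affine_change.

Lemma measurable_affine {R : realType} d (T : measurableType d) (f : R -> T)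
    (c e : R) :
  measurable_fun setT f -> measurable_fun setT (fun t => f (c * t + e)).
Proof.
move=> mf; apply: (measurableT_comp mf).
by apply: measurable_funD => //; apply: measurable_funM.
Qed.

Lemma pmuleBr {R : realType} (c : R) (a b : \bar R) : 0 < c ->
  (c%:E * (a - b) = c%:E * a - c%:E * b)%E.
Proof.
move=> c0; have cy : (c%:E * +oo = +oo)%E by rewrite gt0_muley ?lte_fin.
have cNy : (c%:E * -oo = -oo)%E by rewrite gt0_muleNy ?lte_fin.
by case: a => [a||]; case: b => [b||]; rewrite ?(cy, cNy) -?EFinM -?EFinB //=
  -?EFinM ?mulrBr ?(cy, cNy).
Qed.

(** The positive and the negative parts are scaled separately; [pmuleBr] covers
    the case where both of their integrals are infinite. *)
Lemma integral_affine {R : realType} (c e : R) (f : R -> R) : 0 < c ->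
  measurable_fun setT f ->
  (\int[@lebesgue_measure R]_t (f t)%:E =
   c%:E * \int[@lebesgue_measure R]_t (f (c * t + e))%:E)%E.
Proof.
move=> c0 mf; rewrite [in LHS]integralE [in RHS]integralE.
have mEf : measurable_fun setT (EFin \o f) by exact/measurable_EFinP.
rewrite (@ge0_integral_affine _ c e c0 (EFin \o f)^\+%E)//;
  last exact: measurable_funepos.
rewrite (@ge0_integral_affine _ c e c0 (EFin \o f)^\-%E)//;
  last exact: measurable_funeneg.
rewrite [RHS](pmuleBr _ _ _ c0).
by congr (_ * _ - _ * _)%E; apply: eq_integral => t _;
  rewrite ?(funeposE, funenegE).
Qed.

(** Tonelli gives integrability for the product measure; Fubini then applies.
    The two pointwise hypotheses allow the inner integrals to be read in R. *)
Lemma Rintegral_exchange {R : realType} (F : R -> R -> R) :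
  let mu := @lebesgue_measure R in
  measurable_fun setT (fun p : R * R => F p.1 p.2) ->
  (\int[mu]_t \int[mu]_s `|F t s|%:E < +oo)%E ->
  (forall t, mu.-integrable setT (fun s => (F t s)%:E)) ->
  (forall s, mu.-integrable setT (fun t => (F t s)%:E)) ->
  \int[mu]_t \int[mu]_s F t s = \int[mu]_s \int[mu]_t F t s.
Proof.
move=> mu mF Ffin F1 F2; rewrite /Rintegral; congr fine.
under eq_integral => t _ do rewrite fineK ?integrable_fin_num//.
under [RHS]eq_integral => t _ do rewrite fineK ?integrable_fin_num//.
apply: (@Fubini _ _ _ _ R mu mu (fun p : R * R => (F p.1 p.2)%:E)).
apply/integrable12ltyP => //; exact/measurable_EFinP.
Qed.

(** If a nonnegative integral is 0, the integrand vanishes almost everywhere,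
    which a positive integrand cannot do on an interval. *)
Lemma integral_itv_gt0 {R : realType} (a b : R) (f : R -> R) : a < b ->
  measurable_fun `]a, b[ f -> (forall t, a < t < b -> 0 < f t) ->
  (0 < \int[@lebesgue_measure R]_(t in `]a, b[) (f t)%:E)%E.
Proof.
move=> ab mf f0.
have mEf : measurable_fun `]a, b[ (EFin \o f) by exact/measurable_EFinP.
rewrite lt_neqAle eq_sym; apply/andP; split; last first.
  by apply: integral_ge0 => t /=; rewrite in_itv/= lee_fin => /f0/ltW.
apply/eqP => int0.
have absint0 :
    (\int[@lebesgue_measure R]_(t in `]a, b[) `|(EFin \o f) t| = 0)%E.
  rewrite -int0; apply: eq_integral => t; rewrite inE/= in_itv/= => /f0 ft0.
  by rewrite gtr0_norm.
have [N [mN N0 subN]] := (ae_eq_integral_abs (@lebesgue_measure R)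
  (measurable_itv _) mEf).1 absint0.
have : (lebesgue_measure `]a, b[%classic <= lebesgue_measure N :> \bar R)%E.
  apply: le_measure; rewrite ?inE//= => t /= tab.
  apply: subN => /= /(_ tab); move: tab; rewrite in_itv/= => /f0 ft0 [].
  by apply/eqP; rewrite gt_eqF.
rewrite N0 lebesgue_measure_itv/= lte_fin ab -EFinB lee_fin subr_le0.
by rewrite leNgt ab.
Qed.

(** For a < 1 the integrand is unbounded at 0: the fundamental theorem of
    calculus gives (1 - e^a) / a on [e, 1], and e = 1 / (n + 2) tends to 0. *)
Lemma integral_powR01 {R : realType} (a : R) : 0 < a ->
  (\int[@lebesgue_measure R]_(t in `]0%R, 1%R[) (t `^ (a - 1))%:E = a^-1%:E)%E.
Proof.
move=> a0; set mu := @lebesgue_measure R.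
pose F (n : nat) : set R := `[n.+2%:R^-1, 1]%classic.
have mf (D : set R) : measurable D ->
    measurable_fun D (fun t : R => (t `^ (a - 1))%:E).
  move=> mD; apply/measurable_EFinP/measurable_funTS; exact: measurable_powR.
have Fint n : (\int[mu]_(t in F n) (t `^ (a - 1))%:E =
    ((1 - (n.+2%:R^-1) `^ a) / a)%:E)%E.
  have e0 : 0 < n.+2%:R^-1 :> R by rewrite invr_gt0 ltr0n.
  have e1 : n.+2%:R^-1 < 1 :> R by rewrite invf_lt1 ?ltr1n ?ltr0n.
  have dP (t : R) : 0 < t ->
      is_derive t 1 (fun t => a^-1 * t `^ a) (t `^ (a - 1)).
    move=> t0; have dt := is_derive1_powR a t0.
    apply: (is_derive_eq (is_deriveZ a^-1 dt)).
    by rewrite /GRing.scale/= mulrA mulVf ?gt_eqF// mul1r.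
  have cP (t : R) : 0 < t -> {for t, continuous (fun t => a^-1 * t `^ a)}.
    move=> t0; apply: differentiable_continuous; apply/derivable1_diffP.
    by have /@ex_derive := dP _ t0.
  rewrite (@continuous_FTC2 _ _ (fun t : R => a^-1 * t `^ a))//.
  - by rewrite powR1 -EFinB mulr1 -[X in X - _]mulr1 -mulrBr mulrC.
  - apply: continuous_in_subspaceT => t; rewrite inE/= in_itv/= => /andP[et _].
    have t0 : 0 < t by exact: lt_le_trans et.
    apply: differentiable_continuous; apply/derivable1_diffP.
    by have /@ex_derive := is_derive1_powR (a - 1) t0.
  - split.
    + move=> t; rewrite in_itv/= => /andP[et _].
      by have /@ex_derive := dP _ (lt_trans e0 et).
    + by apply: cvg_at_right_filter; exact: cP.
    + by apply: cvg_at_left_filter; exact: cP.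
  - move=> t; rewrite in_itv/= => /andP[et _]; rewrite derive1E.
    by have /@derive_val -> := dP _ (lt_trans e0 et).
have cvgF : (\int[mu]_(t in F n) (t `^ (a - 1))%:E)%E @[n --> \oo] -->
    (\int[mu]_(t in \bigcup_n F n) (t `^ (a - 1))%:E)%E.
  apply: ge0_nondecreasing_set_cvg_integral.
  - move=> m n mn; rewrite subsetEset => t; rewrite /F/= !in_itv/=.
    move=> /andP[mt ->]; rewrite andbT; apply: le_trans mt.
    by rewrite lef_pV2 ?posrE ?ltr0n// ler_nat.
  - by move=> n; exact: measurable_itv.
  - by move=> n; apply: mf; exact: measurable_itv.
  - by move=> n t _; rewrite lee_fin powR_ge0.
have UF : \bigcup_n F n = `]0, 1]%classic.
  apply/seteqP; split => [t [n _]|t] /=; rewrite /F/= !in_itv/= => /andP[t0 t1].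
    by rewrite t1 andbT (lt_le_trans _ t0)// invr_gt0 ltr0n.
  exists (Num.truncn t^-1) => //=; rewrite in_itv/= t1 andbT.
  rewrite invf_ple ?posrE ?ltr0n//.
  by rewrite ltW// (lt_trans (truncnS_gt _))// ltr_nat.
have -> : (\int[mu]_(t in `]0%R, 1%R[) (t `^ (a - 1))%:E =
    \int[mu]_(t in `]0%R, 1%R]) (t `^ (a - 1))%:E)%E.
  by rewrite integral_itv_bndo_bndc//; apply: mf; exact: measurable_itv.
have cvgV : (1 - (n.+2%:R^-1) `^ a) / a @[n --> \oo] --> a^-1.
  rewrite [X in _ --> X](_ : _ = (1 - 0) / a); last by rewrite subr0 mul1r.
  apply: cvgM; last exact: cvg_cst.
  apply: cvgB; first exact: cvg_cst.
  apply: (@cvg_comp _ _ _ (fun n : nat => n.+2%:R^-1)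
    (fun t : R => t `^ a) _ 0^'+).
    move=> P [e /= e0 Pe]; have := @cvg_harmonic R.
    move=> /cvgrPdist_lt /(_ _ e0) [N _ NP]; exists N => // n Nn /=.
    apply: Pe; last by rewrite invr_gt0 ltr0n.
    by have := NP n.+1 (leqW Nn); rewrite /harmonic.
  exact: powR_cvg0.
rewrite -UF -(cvg_lim _ cvgF)// -(cvg_lim _ cvgV)// -EFin_lim//; last first.
  by apply/cvg_ex; eexists; exact: cvgV.
by congr (limn _); apply/funext => n; rewrite Fint.
Qed.

(** * The real Gamma and Beta integrals *)

Section real_gamma.
Context {R : realType}.
Local Notation mu := (@lebesgue_measure R).
Implicit Types a b s t x : R.

(** Extended by 0, so that all integrals run over the whole line and the
    affine changes of variable do not move any bound. *)
Definition gamma_kernel a t : R :=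
  if 0 < t then t `^ (a - 1) * expR (- t) else 0.

Definition beta_kernel a b x : R :=
  if 0 < x < 1 then x `^ (a - 1) * (1 - x) `^ (b - 1) else 0.

Definition gamma_int a : \bar R := (\int[mu]_t (gamma_kernel a t)%:E)%E.

Definition beta_int a b : \bar R := (\int[mu]_x (beta_kernel a b x)%:E)%E.

Lemma gamma_kernel_ge0 a t : 0 <= gamma_kernel a t.
Proof.
rewrite /gamma_kernel; case: ifP => // _.
by rewrite mulr_ge0 ?powR_ge0 ?expR_ge0.
Qed.

Lemma beta_kernel_ge0 a b x : 0 <= beta_kernel a b x.
Proof.
by rewrite /beta_kernel; case: ifP => // _; rewrite mulr_ge0 ?powR_ge0.
Qed.

Lemma measurable_gamma_kernel a : measurable_fun setT (gamma_kernel a).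
Proof.
apply: measurable_fun_ifT => //; first exact: measurable_fun_ltr.
apply: measurable_funM; first exact: measurable_powR.
by apply: measurableT_comp => //; exact: measurable_expR.
Qed.

Lemma measurable_beta_kernel a b : measurable_fun setT (beta_kernel a b).
Proof.
apply: measurable_fun_ifT => //.
  by apply: measurable_and; apply: measurable_fun_ltr.
apply: measurable_funM; first exact: measurable_powR.
apply: (measurableT_comp (measurable_powR _)).
exact: measurable_funB.
Qed.

Lemma gamma_int_ge0 a : (0 <= gamma_int a)%E.
Proof. by apply: integral_ge0 => t _; rewrite lee_fin gamma_kernel_ge0. Qed.

Lemma beta_int_ge0 a b : (0 <= beta_int a b)%E.
Proof. by apply: integral_ge0 => t _; rewrite lee_fin beta_kernel_ge0. Qed.

Lemma gamma_kernel_le0 a t : t <= 0 -> gamma_kernel a t = 0.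
Proof. by rewrite /gamma_kernel ltNge => ->. Qed.

(** The substitution t = s x in the convolution of two Gamma kernels, at the
    level of integrands. *)
Lemma gamma_kernel_conv a b s x : 0 < s ->
  s * (gamma_kernel a (s * x) * gamma_kernel b (s - s * x)) =
  gamma_kernel (a + b) s * beta_kernel a b x.
Proof.
move=> s0; rewrite /gamma_kernel /beta_kernel s0 pmulr_rgt0// subr_gt0.
rewrite gtr_pMr//.
have [x0|] := boolP (0 < x); last by rewrite mul0r !mulr0.
have [x1|] := boolP (x < 1); last by rewrite !mulr0.
have x1' : 0 < 1 - x by rewrite subr_gt0.
have -> : s - s * x = s * (1 - x) by ring.
rewrite !powRM ?ltW//.
have -> : - s = - (s * x) + - (s * (1 - x)) by ring.
have -> : a + b - 1 = 1 + (a - 1) + (b - 1) by ring.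
have sD u v : s `^ (u + v) = s `^ u * s `^ v.
  by rewrite powRD// (gt_eqF s0) implybT.
rewrite expRD (sD (1 + (a - 1))) (sD 1) powRr1 ?ltW//.
by rewrite /=; ring.
Qed.

Lemma gamma_kernel_conv0 a b s t : s <= 0 ->
  gamma_kernel a t * gamma_kernel b (s - t) = 0.
Proof.
move=> s0; have [t0|t0] := leP t 0; first by rewrite gamma_kernel_le0// mul0r.
by rewrite (@gamma_kernel_le0 b) ?mulr0//; lra.
Qed.

Lemma measurable_conv a b :
  measurable_fun setT
    (fun p : R * R => gamma_kernel a p.1 * gamma_kernel b (p.2 - p.1)).
Proof.
apply: measurable_funM.
  by apply: (measurableT_comp (measurable_gamma_kernel a)).
apply: (measurableT_comp (measurable_gamma_kernel b)).
exact: measurable_funB.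
Qed.

Lemma integral_conv1 a b t :
  (\int[mu]_s (gamma_kernel a t * gamma_kernel b (s - t))%:E =
   (gamma_kernel a t)%:E * gamma_int b)%E.
Proof.
have mb := measurable_gamma_kernel b.
under eq_integral => s _ do rewrite EFinM.
rewrite ge0_integralZl//; last 3 first.
- apply/measurable_EFinP; apply: (measurableT_comp mb); exact: measurable_funB.
- by move=> s _; rewrite lee_fin gamma_kernel_ge0.
- by rewrite lee_fin gamma_kernel_ge0.
congr (_ * _)%E; rewrite /gamma_int (integral_affine 1 (- t))// mul1e.
by apply: eq_integral => s _; rewrite mul1r.
Qed.

Lemma integral_conv2 a b s :
  (\int[mu]_t (gamma_kernel a t * gamma_kernel b (s - t))%:E =
   (gamma_kernel (a + b) s)%:E * beta_int a b)%E.
Proof.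
have [s0|s0] := leP s 0.
  rewrite gamma_kernel_le0// mul0e.
  by apply: integral0_eq => t _; rewrite gamma_kernel_conv0.
rewrite (integral_affine s 0)//; last first.
  apply: measurable_funM; first exact: measurable_gamma_kernel.
  apply: (measurableT_comp (measurable_gamma_kernel b)); exact: measurable_funB.
rewrite -ge0_integralZl//; last 3 first.
- apply/measurable_EFinP; apply: measurable_funM.
    by apply: measurable_affine; exact: measurable_gamma_kernel.
  apply: (measurableT_comp (measurable_gamma_kernel b)).
  by apply: measurable_funB => //; apply: measurable_funD => //;
    apply: measurable_funM.
- by move=> t _; rewrite lee_fin mulr_ge0 ?gamma_kernel_ge0.
- by rewrite lee_fin ltW.
rewrite -ge0_integralZl//; last 3 first.
- by apply/measurable_EFinP; exact: measurable_beta_kernel.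
- by move=> t _; rewrite lee_fin beta_kernel_ge0.
- by rewrite lee_fin gamma_kernel_ge0.
by apply: eq_integral => x _; rewrite addr0 -!EFinM gamma_kernel_conv.
Qed.

(** The left-hand side is the integral over the plane of the convolution
    integrand; integrating in the other order and scaling by s separates the
    two factors on the right. *)
Lemma gamma_int_mul a b :
  (gamma_int a * gamma_int b = beta_int a b * gamma_int (a + b))%E.
Proof.
transitivity (\int[mu]_t \int[mu]_s
    (gamma_kernel a t * gamma_kernel b (s - t))%:E)%E.
  under [RHS]eq_integral => t _ do rewrite integral_conv1.
  rewrite ge0_integralZr//; last 2 first.
  - by move=> t _; rewrite lee_fin gamma_kernel_ge0.
  - exact: gamma_int_ge0.
  by apply/measurable_EFinP; exact: measurable_gamma_kernel.
have mconv : measurable_fun setT (fun p : R * R =>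
    (gamma_kernel a p.1 * gamma_kernel b (p.2 - p.1))%:E).
  by apply/measurable_EFinP; exact: measurable_conv.
have conv0 (p : R * R) :
    (0 <= (gamma_kernel a p.1 * gamma_kernel b (p.2 - p.1))%:E)%E.
  by rewrite lee_fin mulr_ge0 ?gamma_kernel_ge0.
transitivity (\int[mu]_s \int[mu]_t
    (gamma_kernel a t * gamma_kernel b (s - t))%:E)%E.
  exact: (fubini_tonelli (m1 := mu) (m2 := mu) _ mconv conv0).
under eq_integral => t _ do rewrite integral_conv2.
rewrite ge0_integralZr//; last 3 first.
- by apply/measurable_EFinP; exact: measurable_gamma_kernel.
- by move=> t _; rewrite lee_fin gamma_kernel_ge0.
- exact: beta_int_ge0.
by rewrite muleC.
Qed.

Lemma beta_int1 a : 0 < a -> beta_int a 1 = a^-1%:E.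
Proof.
move=> a0; rewrite -integral_powR01// integral_mkcond.
apply: eq_integral => t _.
rewrite patchE /beta_kernel mem_setE in_itv/=; case: ifP => // t01.
by rewrite subrr powRr0 mulr1.
Qed.

Lemma gamma_int1 : gamma_int 1 = 1%E.
Proof.
rewrite -(@integral_exponential_pdf R 1)//.
transitivity (\int[mu]_(t in `]0%R, +oo[) (expR (- t))%:E)%E.
  rewrite [RHS]integral_mkcond; apply: eq_integral => t _.
  rewrite patchE mem_setE in_itv/= andbT /gamma_kernel; case: ifP => // t0.
  by rewrite subrr powRr0 mul1r.
rewrite integral_itv_obnd_cbnd//; last first.
  apply/measurable_EFinP/measurable_funTS.
  by apply: measurableT_comp => //; exact: measurable_expR.
rewrite [LHS]integral_mkcond; apply: eq_integral => t _.
by rewrite /exponential_pdf !patchE; case: ifP => //; rewrite mul1r mulN1r.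
Qed.

(** On ]0, 1[ the kernel is at most t^(a-1); for t >= 1 it is at most a
    multiple of e^(-t/2), because t^n e^(-t/2) <= n! 2^n. *)
Lemma gamma_int_lty a : 0 < a -> (gamma_int a < +oo)%E.
Proof.
move=> a0; set m := Num.truncn a; set C : R := 2 * (m.+1`!%:R * 2 ^+ m.+1).
have C0 : 0 <= C by rewrite mulr_ge0// mulr_ge0 ?exprn_ge0.
have mE : measurable_fun setT (fun t : R => (exponential_pdf 2^-1 t)%:E).
  apply/measurable_EFinP; apply: measurable_exponential_pdf.
apply: (@le_lt_trans _ _
  (\int[mu]_t ((beta_kernel a 1 t)%:E + C%:E * (exponential_pdf 2^-1 t)%:E)))%E.
  apply: ge0_le_integral => //.
  - by move=> t _; rewrite lee_fin gamma_kernel_ge0.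
  - by apply/measurable_EFinP; exact: measurable_gamma_kernel.
  - apply: emeasurable_funD; last exact: measurable_funeM.
    by apply/measurable_EFinP; exact: measurable_beta_kernel.
  move=> t _; rewrite lee_fin /gamma_kernel; case: ifP => t0; last first.
    by rewrite addr_ge0 ?beta_kernel_ge0// mulr_ge0// exponential_pdf_ge0.
  rewrite /beta_kernel t0/=; case: ifP => t1.
    rewrite -[leLHS]addr0 lerD//; last first.
      by rewrite mulr_ge0// exponential_pdf_ge0.
    by rewrite ler_wpM2l ?powR_ge0// subrr powRr0 expR_le1 oppr_le0 ltW.
  rewrite add0r exponential_pdfE ?(ltW t0)//.
  have -> : - t = - 2^-1 * t + - 2^-1 * t by field.
  rewrite expRD mulrA /C.
  have -> : 2 * (m.+1`!%:R * 2 ^+ m.+1) * (2^-1 * expR (- 2^-1 * t)) =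
    (m.+1`!%:R * 2 ^+ m.+1) * expR (- 2^-1 * t) by field.
  rewrite ler_wpM2r ?expR_ge0//.
  apply: (@le_trans _ _ (t ^+ m.+1 * expR (- 2^-1 * t))).
    rewrite ler_wpM2r ?expR_ge0// -powR_mulrn ?(ltW t0)//.
    apply: ler_powR; first by rewrite leNgt t1.
    have := truncnS_gt a; rewrite -/m; lra.
  have := expR_ge1Dxn m (ltac:(lra) : 0 <= t / 2) .
  rewrite mulNr expRN ler_pdivrMr ?expR_gt0// => h.
  apply: (@le_trans _ _
      (m.+1`!%:R * 2 ^+ m.+1 * ((t / 2) ^+ m.+1 / m.+1`!%:R))).
    rewrite le_eqVlt expr_div_n; apply/orP; left; apply/eqP; field.
    by rewrite expf_neq0 ?pnatr_eq0// -lt0n fact_gt0.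
  rewrite ler_wpM2l// ?mulr_ge0 ?exprn_ge0// [2^-1 * t]mulrC.
  by apply: le_trans h; rewrite lerDr.
rewrite ge0_integralD//; last 4 first.
- by move=> t _; rewrite lee_fin beta_kernel_ge0.
- by apply/measurable_EFinP; exact: measurable_beta_kernel.
- by move=> t _; rewrite mule_ge0 ?lee_fin// exponential_pdf_ge0.
- exact: measurable_funeM.
rewrite -/(beta_int a 1) beta_int1// ge0_integralZl//; last first.
  by move=> t _; rewrite lee_fin exponential_pdf_ge0.
by rewrite integral_exponential_pdf// mule1 -EFinD ltry.
Qed.

Lemma gamma_int_gt0 a : (0 < gamma_int a)%E.
Proof.
rewrite /gamma_int; apply: (@lt_le_trans _ _
  (\int[mu]_(t in `]0%R, 1%R[) (gamma_kernel a t)%:E)%E).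
  apply: integral_itv_gt0 => //.
    by apply: measurable_funTS; exact: measurable_gamma_kernel.
  move=> t /andP[t0 _].
  by rewrite /gamma_kernel t0 mulr_gt0 ?powR_gt0 ?expR_gt0.
apply: ge0_subset_integral => //.
  by apply/measurable_EFinP; exact: measurable_gamma_kernel.
by move=> t _; rewrite lee_fin gamma_kernel_ge0.
Qed.

Definition rgamma a : R := fine (gamma_int a).

Lemma rgammaE a : 0 < a -> gamma_int a = (rgamma a)%:E.
Proof.
by move=> a0; rewrite fineK// ge0_fin_numE ?gamma_int_ge0 ?gamma_int_lty.
Qed.

Lemma rgamma_gt0 a : 0 < a -> 0 < rgamma a.
Proof. by move=> a0; rewrite -lte_fin -rgammaE ?gamma_int_gt0. Qed.

Lemma beta_intE a b : 0 < a -> 0 < b ->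
  beta_int a b = (rgamma a * rgamma b / rgamma (a + b))%:E.
Proof.
move=> a0 b0; have ab0 : 0 < a + b by rewrite addr_gt0.
have := gamma_int_mul a b; rewrite !rgammaE// !EFinM => ->.
by rewrite -muleA -EFinM divff ?mule1// gt_eqF// rgamma_gt0.
Qed.

(** Since B(a, 1) = 1 / a, this is [gamma_int_mul] with second argument 1. *)
Lemma rgamma1D a : 0 < a -> rgamma (a + 1) = a * rgamma a.
Proof.
move=> a0; have := gamma_int_mul a 1.
rewrite gamma_int1 beta_int1// mule1 !rgammaE ?addr_gt0// -EFinM => -[->].
by rewrite mulrA divff ?mul1r// gt_eqF.
Qed.

End real_gamma.

(** * Complex numbers and complex powers of positive reals *)

Section complex_prelim.
Context {R : realType}.
Local Notation C := R[i].
Implicit Types z w : C.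

Lemma ReD z w : Re (z + w) = Re z + Re w. Proof. by case: z; case: w. Qed.
Lemma ImD z w : Im (z + w) = Im z + Im w. Proof. by case: z; case: w. Qed.
Lemma ReB z w : Re (z - w) = Re z - Re w. Proof. by case: z; case: w. Qed.
Lemma ReM z w : Re (z * w) = Re z * Re w - Im z * Im w.
Proof. by case: z; case: w. Qed.
Lemma ImM z w : Im (z * w) = Re z * Im w + Im z * Re w.
Proof. by case: z => a b; case: w. Qed.
Lemma eq_ReIm z w : Re z = Re w -> Im z = Im w -> z = w.
Proof. by case: z => a b; case: w => c d /= -> ->. Qed.

Lemma normc_ge0 z : 0 <= normc z.
Proof. by case: z => a b; rewrite sqrtr_ge0. Qed.

Lemma normc_eq0 z : (normc z == 0) = (z == 0).
Proof.
apply/eqP/eqP => [/Normc.eq0_normc//|->].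
exact: Normc.normc0.
Qed.

Lemma normc_gt0 z : (0 < normc z) = (z != 0).
Proof. by rewrite lt_neqAle normc_ge0 andbT eq_sym normc_eq0. Qed.

Lemma normc_real (r : R) : normc r%:C = `|r|.
Proof. by rewrite /= expr0n addr0 sqrtr_sqr. Qed.

Lemma Re_le_normc z : `|Re z| <= normc z.
Proof.
case: z => a b /=; rewrite -sqrtr_sqr ler_sqrt ?lerDl ?sqr_ge0//.
by rewrite addr_ge0 ?sqr_ge0.
Qed.

Lemma Im_le_normc z : `|Im z| <= normc z.
Proof.
case: z => a b /=; rewrite -sqrtr_sqr ler_sqrt ?lerDr ?sqr_ge0//.
by rewrite addr_ge0 ?sqr_ge0.
Qed.

Lemma normc_le_ReIm z : normc z <= `|Re z| + `|Im z|.
Proof.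
case: z => a b /=; rewrite -(@ler_pXn2r _ 2%N) ?nnegrE ?sqrtr_ge0 ?addr_ge0//.
rewrite sqr_sqrtr ?addr_ge0 ?sqr_ge0// sqrrD !real_normK ?num_real//.
by rewrite lerD2r lerDl mulrn_wge0// mulr_ge0.
Qed.

Lemma cexpD z w : cexp (z + w) = cexp z * cexp w.
Proof.
rewrite /cexp ReD ImD expRD cosD sinD.
by apply: eq_ReIm; rewrite !(ReM, ImM)/=; ring.
Qed.

Lemma normc_cexp z : normc (cexp z) = expR (Re z).
Proof.
rewrite /cexp Normc.normcM normc_real ger0_norm ?expR_ge0//=.
by rewrite cos2Dsin2 sqrtr1 mulr1.
Qed.

Lemma cpowRD (t : R) z w : cpowR t (z + w) = cpowR t z * cpowR t w.
Proof. by rewrite /cpowR mulrDr cexpD. Qed.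

Lemma cpowRM (s t : R) z : 0 < s -> 0 < t ->
  cpowR (s * t) z = cpowR s z * cpowR t z.
Proof.
by move=> s0 t0; rewrite /cpowR lnM ?posrE// rmorphD/= mulrDl cexpD.
Qed.

Lemma cpowR_real (t r : R) : 0 < t -> cpowR t r%:C = (t `^ r)%:C.
Proof.
move=> t0; rewrite /cpowR -rmorphM/= /cexp/= cos0 sin0.
by rewrite mulr1 /powR gt_eqF// mulrC.
Qed.

Lemma cpowR1 (t : R) : 0 < t -> cpowR t 1 = t%:C.
Proof. by move=> t0; rewrite -[1]/((1 : R)%:C) cpowR_real// powRr1// ltW. Qed.

Lemma normc_cpowR (t : R) z : 0 < t -> normc (cpowR t z) = t `^ Re z.
Proof.
move=> t0; rewrite /cpowR normc_cexp ReM/= mul0r subr0.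
by rewrite /powR gt_eqF// mulrC.
Qed.

End complex_prelim.

Section complex_measurable.
Context d (T : measurableType d) {R : realType}.
Local Notation C := R[i].
Implicit Types f g : T -> C.

Definition cmeasurable f :=
  measurable_fun setT (fun t => Re (f t)) /\
  measurable_fun setT (fun t => Im (f t)).

Lemma cmeasurableM f g : cmeasurable f -> cmeasurable g ->
  cmeasurable (fun t => f t * g t).
Proof.
move=> [mf1 mf2] [mg1 mg2]; split.
  under eq_fun do rewrite ReM.
  by apply: measurable_funB; apply: measurable_funM.
under eq_fun do rewrite ImM.
by apply: measurable_funD; apply: measurable_funM.
Qed.

Lemma cmeasurable_cst (c : C) : cmeasurable (fun _ => c).
Proof. by split; exact: measurable_cst. Qed.

Lemma cmeasurable_if (b : T -> bool) f g : measurable_fun setT b ->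
  cmeasurable f -> cmeasurable g ->
  cmeasurable (fun t => if b t then f t else g t).
Proof.
move=> mb [mf1 mf2] [mg1 mg2]; split.
  under eq_fun do rewrite (fun_if (@Re R)).
  exact: measurable_fun_ifT.
under eq_fun do rewrite (fun_if (@Im R)).
exact: measurable_fun_ifT.
Qed.

Lemma cmeasurable_real (h : T -> R) : measurable_fun setT h ->
  cmeasurable (fun t => (h t)%:C).
Proof. by move=> mh; split => //; exact: measurable_cst. Qed.

Lemma cmeasurable_cpowR (h : T -> R) z : measurable_fun setT h ->
  cmeasurable (fun t => cpowR (h t) z).
Proof.
move=> mh.
have mlnh : measurable_fun setT (fun t => ln (h t)).
  exact: (measurableT_comp (@measurable_ln R)).
have mE : measurable_fun setT (fun t => ln (h t) * Im z).
  exact: measurable_funM.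
rewrite /cpowR /cexp; apply: cmeasurableM.
  apply: cmeasurable_real.
  under eq_fun do rewrite ReM/= mul0r subr0.
  apply: (measurableT_comp (@measurable_expR R)); exact: measurable_funM.
split => /=; under eq_fun do rewrite ImM/= mul0r addr0.
- apply: measurableT_comp mE.
  by apply: continuous_measurable_fun; exact: continuous_cos.
- apply: measurableT_comp mE.
  by apply: continuous_measurable_fun; exact: continuous_sin.
Qed.

Lemma measurable_normc f : cmeasurable f ->
  measurable_fun setT (fun t => normc (f t)).
Proof.
move=> [mf1 mf2].
rewrite (_ : (fun _ => _) = fun t => Num.sqrt (Re (f t) ^+ 2 + Im (f t) ^+ 2)).
  apply: (measurableT_comp (continuous_measurable_fun (@sqrt_continuous R))).
  by apply: measurable_funD; apply: measurable_funX.
by apply/funext => t; case: (f t).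
Qed.

End complex_measurable.
Arguments cmeasurable {d T R} f.

Lemma cmeasurable_comp {d d'} {T : measurableType d} {T' : measurableType d'}
    {R : realType} (f : T' -> R[i]) (h : T -> T') :
  cmeasurable f -> measurable_fun setT h -> cmeasurable (f \o h).
Proof.
by move=> [mf1 mf2] mh; split; [exact: (measurableT_comp mf1)
                                |exact: (measurableT_comp mf2)].
Qed.

(** * Integration of complex functions *)

Section complex_integral.
Context {R : realType}.
Local Notation C := R[i].
Local Notation mu := (@lebesgue_measure R).
Implicit Types (f : R -> C) (D : set R).

Lemma eq_cintegral D f g : (forall t, D t -> f t = g t) ->
  cintegral D f = cintegral D g.
Proof.
move=> fg; rewrite /cintegral; congr Complex; apply: eq_Rintegral => t;
  by rewrite inE => /fg ->.
Qed.

Lemma eq_cintegrable D f g : measurable D -> (forall t, D t -> f t = g t) ->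
  cintegrable D f -> cintegrable D g.
Proof.
move=> mD fg [h1 h2]; split.
  by apply: eq_integrable h1 => // t; rewrite inE => /fg ->.
by apply: eq_integrable h2 => // t; rewrite inE => /fg ->.
Qed.

Lemma cintegral_mkcond D f :
  cintegral D f = cintegral setT (fun t => if t \in D then f t else 0).
Proof.
rewrite /cintegral; congr Complex; rewrite Rintegral_mkcond;
  by apply: eq_Rintegral => t _; rewrite patchE; case: ifP.
Qed.

Lemma cintegrable_mkcond D f : measurable D ->
  cintegrable D f <-> cintegrable setT (fun t => if t \in D then f t else 0).
Proof.
move=> mD.
have patchif (h : C -> R) : h 0 = 0 -> (fun t => (h (f t))%:E) \_ D =
    (fun t => (h (if t \in D then f t else 0))%:E).
  by move=> h0; apply/funext => t; rewrite patchE; case: ifP; rewrite ?h0.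
have := @integrable_mkcond _ _ _ mu _ (fun t => (Re (f t))%:E) mD.
have := @integrable_mkcond _ _ _ mu _ (fun t => (Im (f t))%:E) mD.
rewrite (patchif (@Re R))// (patchif (@Im R))// => eI eR.
by split=> -[/eR fR /eI fI].
Qed.

Lemma cintegrable_normcP f : cmeasurable f ->
  (\int[mu]_t (normc (f t))%:E < +oo)%E -> cintegrable setT f.
Proof.
move=> mf foo; have mn := measurable_normc _ _ _ mf; case: (mf) => mf1 mf2.
have iN : mu.-integrable setT (fun t => (normc (f t))%:E).
  apply/integrableP; split; first exact/measurable_EFinP.
  under eq_integral => t _ do rewrite gee0_abs ?lee_fin ?normc_ge0//.
  exact: foo.
split; apply: le_integrable iN => //;
  [exact/measurable_EFinP| |exact/measurable_EFinP|].
  by move=> t _; rewrite lee_fin (ger0_norm (normc_ge0 _)) Re_le_normc.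
by move=> t _; rewrite lee_fin (ger0_norm (normc_ge0 _)) Im_le_normc.
Qed.

Let integrable_lin D (u v : R -> R) (r s : R) : measurable D ->
  mu.-integrable D (EFin \o u) -> mu.-integrable D (EFin \o v) ->
  mu.-integrable D (EFin \o (fun t => r * u t + s * v t)) /\
  \int[mu]_(t in D) (r * u t + s * v t) =
    r * (\int[mu]_(t in D) u t) + s * (\int[mu]_(t in D) v t).
Proof.
move=> mD' iu iv; have mD : @measurable _ (measurableTypeR R) D := mD'.
have ru : mu.-integrable D (EFin \o (fun t => r * u t)).
  by apply: eq_integrable (integrableZl mD r iu) => // t _; rewrite /= EFinM.
have sv : mu.-integrable D (EFin \o (fun t => s * v t)).
  by apply: eq_integrable (integrableZl mD s iv) => // t _; rewrite /= EFinM.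
split; first exact: (integrableD mD ru sv).
by rewrite RintegralD// !RintegralZl.
Qed.

Lemma cintegrableZl D f (c : C) : measurable D -> cintegrable D f ->
  cintegrable D (fun t => c * f t) /\
  cintegral D (fun t => c * f t) = c * cintegral D f.
Proof.
move=> mD [f1 f2].
have [iR eR] := integrable_lin D _ _ (Re c) (- Im c) mD f1 f2.
have [iI eI] := integrable_lin D _ _ (Re c) (Im c) mD f2 f1.
have ReE t : Re (c * f t) = Re c * Re (f t) + - Im c * Im (f t).
  by rewrite ReM mulNr.
split.
  split; [under eq_fun do rewrite ReE|under eq_fun do rewrite ImM].
    exact: iR.
  exact: iI.
apply: eq_ReIm; rewrite ?ReM ?ImM /cintegral/=.
  by under eq_Rintegral do rewrite ReE; rewrite eR mulNr.
by under eq_Rintegral do rewrite ImM; rewrite eI.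
Qed.

Lemma cintegral_affine (c e : R) f : 0 < c -> cmeasurable f ->
  cintegral setT f = c%:C * cintegral setT (fun t => f (c * t + e)).
Proof.
move=> c0 [mf1 mf2].
have finec (x : \bar R) : fine (c%:E * x)%E = c * fine x.
  by case: x => [x||]//=; rewrite ?gt0_muley ?gt0_muleNy ?lte_fin//= mulr0.
apply: eq_ReIm; rewrite ?ReM ?ImM/= mul0r ?subr0 ?addr0.
  by rewrite /Rintegral (integral_affine c e _ c0 mf1) finec.
by rewrite /Rintegral (integral_affine c e _ c0 mf2) finec.
Qed.

Lemma cintegral_exchange (F : R -> R -> C) :
  cmeasurable (fun p : R * R => F p.1 p.2) ->
  (\int[mu]_t \int[mu]_s (normc (F t s))%:E < +oo)%E ->
  (forall t, cintegrable setT (F t)) ->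
  (forall s, cintegrable setT (F ^~ s)) ->
  cintegral setT (fun t => cintegral setT (F t)) =
  cintegral setT (fun s => cintegral setT (F ^~ s)).
Proof.
move=> mF Foo F1 F2; have mn := measurable_normc _ _ _ mF.
case: (mF) => mF1 mF2.
have dom (h : C -> R) : (forall z, `|h z| <= normc z) ->
    measurable_fun setT (fun p : R * R => h (F p.1 p.2)) ->
    (\int[mu]_t \int[mu]_s `|h (F t s)|%:E < +oo)%E.
  move=> hn mh; apply: le_lt_trans Foo; apply: ge0_le_integral => //.
  - by move=> t _; apply: integral_ge0.
  - apply: (measurable_fun_fubini_tonelli_F (m2 := mu)
      (fun p : R * R => `|h (F p.1 p.2)|%:E)) => //.
    by apply/measurable_EFinP; apply: measurableT_comp.
  - apply: (measurable_fun_fubini_tonelli_F (m2 := mu)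
      (fun p : R * R => (normc (F p.1 p.2))%:E)).
      exact/measurable_EFinP.
    by move=> p; rewrite lee_fin normc_ge0.
  - move=> t _; apply: ge0_le_integral => //.
    + apply/measurable_EFinP; apply: measurableT_comp => //.
      by apply: (measurableT_comp mh (measurable_pair1 t)).
    + apply/measurable_EFinP; apply: (measurableT_comp mn (measurable_pair1 t)).
    + by move=> s _; rewrite lee_fin hn.
apply: eq_ReIm => /=.
- apply: (Rintegral_exchange (fun t s => Re (F t s))) => //.
  + by apply: dom => // z; exact: Re_le_normc.
  + by move=> t; case: (F1 t).
  + by move=> t; case: (F2 t).
- apply: (Rintegral_exchange (fun t s => Im (F t s))) => //.
  + by apply: dom => // z; exact: Im_le_normc.
  + by move=> t; case: (F1 t).
  + by move=> t; case: (F2 t).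
Qed.

(** The factor 2 comes from bounding the real and the imaginary part
    separately. *)
Lemma normc_cintegral_le f (g : R -> R) : cintegrable setT f ->
  mu.-integrable setT (EFin \o g) -> (forall t, normc (f t) <= g t) ->
  normc (cintegral setT f) <= 2 * \int[mu]_t g t.
Proof.
move=> [f1 f2] ig fg; apply: (le_trans (normc_le_ReIm _)).
rewrite mulr_natl mulr2n /cintegral; apply: lerD => /=.
  apply: (le_trans (le_normr_Rintegral _ f1)) => //.
  apply: le_Rintegral => //; first exact: (integrable_abse f1).
  by move=> t _; apply: le_trans (Re_le_normc _) (fg t).
apply: (le_trans (le_normr_Rintegral _ f2)) => //.
apply: le_Rintegral => //; first exact: (integrable_abse f2).
by move=> t _; apply: le_trans (Im_le_normc _) (fg t).
Qed.

End complex_integral.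

(** * The complex Gamma and Beta integrals *)

Section complex_gamma.
Context {R : realType}.
Local Notation C := R[i].
Local Notation mu := (@lebesgue_measure R).
Implicit Types (p q z : C) (s t x : R).

Definition cgamma_kernel z t : C :=
  if 0 < t then cpowR t (z - 1) * (expR (- t))%:C else 0.

Definition cbeta_kernel p q x : C :=
  if 0 < x < 1 then cpowR x (p - 1) * cpowR (1 - x) (q - 1) else 0.

Definition cgamma z : C := cintegral setT (cgamma_kernel z).

Definition cbeta p q : C := cintegral setT (cbeta_kernel p q).

Lemma normc_cgamma_kernel z t :
  normc (cgamma_kernel z t) = gamma_kernel (Re z) t.
Proof.
rewrite /cgamma_kernel /gamma_kernel; case: ifP => t0; last exact: Normc.normc0.
by rewrite Normc.normcM normc_cpowR// normc_real ger0_norm ?expR_ge0// ReB.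
Qed.

Lemma normc_cbeta_kernel p q x :
  normc (cbeta_kernel p q x) = beta_kernel (Re p) (Re q) x.
Proof.
rewrite /cbeta_kernel /beta_kernel; case: ifP => [/andP[x0 x1]|_]; last first.
  exact: Normc.normc0.
by rewrite Normc.normcM !normc_cpowR ?subr_gt0// !ReB.
Qed.

Lemma cmeasurable_cgamma_kernel z : cmeasurable (cgamma_kernel z).
Proof.
apply: cmeasurable_if; first exact: measurable_fun_ltr.
  apply: cmeasurableM; first exact: cmeasurable_cpowR.
  apply: cmeasurable_real.
  by apply: measurableT_comp => //; exact: measurable_expR.
exact: cmeasurable_cst.
Qed.

Lemma cmeasurable_cbeta_kernel p q : cmeasurable (cbeta_kernel p q).
Proof.
apply: cmeasurable_if; last exact: cmeasurable_cst.
  by apply: measurable_and; apply: measurable_fun_ltr.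
apply: cmeasurableM; first exact: cmeasurable_cpowR.
by apply: cmeasurable_cpowR; exact: measurable_funB.
Qed.

Lemma cintegrable_cgamma_kernel z : 0 < Re z ->
  cintegrable setT (cgamma_kernel z).
Proof.
move=> z0; apply: cintegrable_normcP; first exact: cmeasurable_cgamma_kernel.
by under eq_integral do rewrite normc_cgamma_kernel; exact: gamma_int_lty.
Qed.

Lemma cintegrable_cbeta_kernel p q : 0 < Re p -> 0 < Re q ->
  cintegrable setT (cbeta_kernel p q).
Proof.
move=> p0 q0; apply: cintegrable_normcP; first exact: cmeasurable_cbeta_kernel.
under eq_integral do rewrite normc_cbeta_kernel.
by rewrite -/(beta_int _ _) beta_intE// ltry.
Qed.

Lemma Euler_GammaE z : Euler_Gamma z = cgamma z.
Proof.
rewrite /Euler_Gamma cintegral_mkcond; apply: eq_cintegral => t _.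
by rewrite /cgamma_kernel mem_setE in_itv/= andbT.
Qed.

Lemma cgamma_kernel_le0 z t : t <= 0 -> cgamma_kernel z t = 0.
Proof. by rewrite /cgamma_kernel ltNge => ->. Qed.

Lemma cgamma_kernel_conv p q s x : 0 < s ->
  s%:C * (cgamma_kernel p (s * x) * cgamma_kernel q (s - s * x)) =
  cgamma_kernel (p + q) s * cbeta_kernel p q x.
Proof.
move=> s0; rewrite /cgamma_kernel /cbeta_kernel s0 pmulr_rgt0// subr_gt0.
rewrite gtr_pMr//.
have [x0|] := boolP (0 < x); last by rewrite mul0r !mulr0.
have [x1|] := boolP (x < 1); last by rewrite !mulr0.
have x1' : 0 < 1 - x by rewrite subr_gt0.
have -> : s - s * x = s * (1 - x) by ring.
rewrite !cpowRM//.
have -> : p + q - 1 = 1 + (p - 1) + (q - 1) by ring.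
rewrite (cpowRD s (1 + (p - 1))) (cpowRD s 1) cpowR1//=.
have -> : (expR (- s))%:C =
    (expR (- (s * x)))%:C * (expR (- (s * (1 - x))))%:C.
  by rewrite -rmorphM/= -expRD; congr (expR _)%:C; ring.
ring.
Qed.

Lemma cgamma_kernel_conv0 p q s t : s <= 0 ->
  cgamma_kernel p t * cgamma_kernel q (s - t) = 0.
Proof.
move=> s0; have [t0|t0] := leP t 0; first by rewrite cgamma_kernel_le0// mul0r.
by rewrite (@cgamma_kernel_le0 q) ?mulr0//; lra.
Qed.

Lemma cintegral0 (D : set R) : cintegral D (fun _ => 0 : C) = 0.
Proof. by rewrite /cintegral /Rintegral integral0/=. Qed.

(** Euler's formula B(p, q) = Gamma (p) Gamma (q) / Gamma (p + q), by the same
    exchange of integrals as for real parameters; the real case, applied to the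
    moduli, gives the absolute convergence that Fubini's theorem needs. *)
Lemma cgamma_mul p q : 0 < Re p -> 0 < Re q ->
  cgamma p * cgamma q = cbeta p q * cgamma (p + q).
Proof.
move=> p0 q0.
pose F t s := cgamma_kernel p t * cgamma_kernel q (s - t).
have normF t s :
    normc (F t s) = gamma_kernel (Re p) t * gamma_kernel (Re q) (s - t).
  by rewrite Normc.normcM !normc_cgamma_kernel.
have mq t : cmeasurable (fun s => cgamma_kernel q (s - t)).
  by apply: (cmeasurable_comp (cgamma_kernel q) (fun s => s - t));
    [exact: cmeasurable_cgamma_kernel|exact: measurable_funB].
have mF : cmeasurable (fun r : R * R => F r.1 r.2).
  apply: cmeasurableM.
    by apply: (cmeasurable_comp (cgamma_kernel p) fst) => //;
      exact: cmeasurable_cgamma_kernel.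
  apply: (cmeasurable_comp (cgamma_kernel q) (fun r : R * R => r.2 - r.1)).
    exact: cmeasurable_cgamma_kernel.
  exact: measurable_funB.
have iq t : cintegrable setT (fun s => cgamma_kernel q (s - t)).
  apply: cintegrable_normcP => //.
  under eq_integral do rewrite normc_cgamma_kernel.
  have := integral_affine 1 (- t) _ ltr01 (measurable_gamma_kernel (Re q)).
  rewrite mul1e; under [in RHS]eq_integral do rewrite mul1r.
  by move=> <-; exact: gamma_int_lty.
have shiftq t : cintegral setT (fun s => cgamma_kernel q (s - t)) = cgamma q.
  rewrite [RHS](cintegral_affine 1 (- t))//; last first.
    exact: cmeasurable_cgamma_kernel.
  by rewrite mul1r; apply: eq_cintegral => s _; rewrite mul1r.
have intF1 t : cintegral setT (F t) = cgamma_kernel p t * cgamma q.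
  rewrite (cintegrableZl _ _ (cgamma_kernel p t) measurableT (iq t)).2.
  by rewrite shiftq.
have intF2 s : cintegral setT (F ^~ s) = cbeta p q * cgamma_kernel (p + q) s.
  have [s0|s0] := leP s 0.
    rewrite cgamma_kernel_le0// mulr0 -[RHS](cintegral0 setT).
    by apply: eq_cintegral => t _; rewrite /F cgamma_kernel_conv0.
  rewrite (cintegral_affine s 0)//; last first.
    apply: cmeasurableM; first exact: cmeasurable_cgamma_kernel.
    apply: (cmeasurable_comp (cgamma_kernel q) (fun t => s - t)).
      exact: cmeasurable_cgamma_kernel.
    exact: measurable_funB.
  have s0' : s%:C != 0 by rewrite -normc_eq0 normc_real normr_eq0 gt_eqF.
  transitivity (s%:C * cintegral setT (fun x =>
      s%:C^-1 * cgamma_kernel (p + q) s * cbeta_kernel p q x)).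
    congr (_ * _); apply: eq_cintegral => x _.
    by rewrite -mulrA -cgamma_kernel_conv// mulKf// addr0.
  have ib := cintegrable_cbeta_kernel _ _ p0 q0.
  rewrite (cintegrableZl _ _ _ measurableT ib).2.
  by rewrite !mulrA divff// mul1r mulrC.
have pq0 : 0 < Re (p + q) by rewrite ReD addr_gt0.
transitivity (cintegral setT (fun t => cintegral setT (F t))).
  under [RHS]eq_cintegral => t _ do rewrite intF1 mulrC.
  rewrite (cintegrableZl _ _ _ measurableT (cintegrable_cgamma_kernel _ p0)).2.
  by rewrite mulrC.
rewrite cintegral_exchange//.
- under eq_cintegral => t _ do rewrite intF2.
  have ig := cintegrable_cgamma_kernel _ pq0.
  by rewrite (cintegrableZl _ _ _ measurableT ig).2.
- under eq_integral => t _ do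
    (under eq_integral => s _ do rewrite normF; rewrite integral_conv1).
  rewrite ge0_integralZr//; last 3 first.
  + by apply/measurable_EFinP; exact: measurable_gamma_kernel.
  + by move=> t _; rewrite lee_fin gamma_kernel_ge0.
  + exact: gamma_int_ge0.
  by rewrite -/(gamma_int _) !rgammaE// -EFinM ltry.
- move=> t; exact: (cintegrableZl _ _ _ measurableT (iq t)).1.
- move=> s; apply: cintegrable_normcP.
    apply: cmeasurableM; first exact: cmeasurable_cgamma_kernel.
    apply: (cmeasurable_comp (cgamma_kernel q) (fun t => s - t)).
      exact: cmeasurable_cgamma_kernel.
    exact: measurable_funB.
  under eq_integral do rewrite normF.
  by rewrite integral_conv2 beta_intE// -EFinM ltry.
Qed.

End complex_gamma.

(** * Gamma does not vanish on the right half-plane *)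

Section nonvanishing.
Context {R : realType}.
Local Notation C := R[i].
Local Notation mu := (@lebesgue_measure R).
Implicit Types (p q z : C) (s t u v x : R).

Lemma sin_le v : 0 <= v -> `|sin v| <= v.
Proof.
rewrite le_eqVlt => /orP[/eqP<-|v0]; first by rewrite sin0 normr0.
have [c _] : exists2 c, c \in `]0, v[ & sin v - sin 0 = cos c * (v - 0).
  apply: MVT => //; apply: continuous_subspaceT => x; exact: continuous_sin.
rewrite sin0 !subr0 => ->; rewrite normrM (gtr0_norm v0) ler_piMl ?(ltW v0)//.
by rewrite ler_norml cos_geN1 cos_le1.
Qed.

Lemma cos_ge v : 1 - v ^+ 2 / 2 <= cos v.
Proof.
wlog v0 : v / 0 <= v => [W|].
  by case: (leP 0 v) => [/W//|v0]; rewrite -cosN -sqrrN W// oppr_ge0 ltW.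
have v2 : v = (v / 2) *+ 2 by rewrite -mulr_natr; field.
have -> : cos v = 1 - 2 * (sin (v / 2)) ^+ 2.
  by rewrite [in LHS]v2 cos_mulr2n cos2sin2; ring.
have sin_v : `|sin (v / 2)| <= v / 2 by apply: sin_le; lra.
have : (sin (v / 2)) ^+ 2 <= (v / 2) ^+ 2.
  by rewrite -real_normK ?num_real// ler_pXn2r ?nnegrE//; lra.
by rewrite expr_div_n; lra.
Qed.

(** With u = e^(2 v), the right-hand side is 4 (e^v - e^(-v))^2, and
    |e^v - e^(-v)| >= |v|. *)
Lemma sqr_ln_le u : 0 < u -> (ln u) ^+ 2 <= 4 * (u + u^-1 - 2).
Proof.
move=> u0; set v := ln u / 2; set e := expR v; have e0 : 0 < e := expR_gt0 v.
have -> : ln u = 2 * v by rewrite /v; field.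
have -> : u = e ^+ 2.
  by rewrite /e -expRM_natr /v divfK ?pnatr_eq0// lnK.
have e1 : 1 + v <= e := expR_ge1Dx v.
have e2 : 1 - v <= e^-1 by rewrite /e -expRN; exact: expR_ge1Dx.
have -> : 4 * (e ^+ 2 + (e ^+ 2)^-1 - 2) = 4 * (e - e^-1) ^+ 2.
  by field; rewrite gt_eqF.
rewrite exprMn; have -> : (2 : R) ^+ 2 = 4 by ring.
rewrite ler_pM2l// -[leLHS]real_normK ?num_real//.
rewrite -[leRHS]real_normK ?num_real//.
rewrite ler_pXn2r ?nnegrE//.
have [v0|v0] := leP 0 v.
  have : e^-1 <= 1 by rewrite /e -expRN expR_le1 oppr_le0.
  by move=> ?; rewrite (ger0_norm v0) (le_trans _ (ler_norm _))//; lra.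
have : e <= 1 by rewrite /e expR_le1 ltW.
by move=> ?; rewrite (ltr0_norm v0) -normrN (le_trans _ (ler_norm _))//; lra.
Qed.

Lemma gamma_kernel1D s t : gamma_kernel (s + 1) t = t * gamma_kernel s t.
Proof.
rewrite /gamma_kernel; case: ifP => t0; last by rewrite mulr0.
have -> : s + 1 - 1 = 1 + (s - 1) by ring.
rewrite (@powRD _ t 1 (s - 1)) ?(gt_eqF t0) ?implybT//.
by rewrite powRr1 ?(ltW t0)// mulrA.
Qed.

Lemma integrable_gamma_kernel s : 0 < s ->
  mu.-integrable setT (EFin \o gamma_kernel s).
Proof.
move=> s0; apply/integrableP; split.
  by apply/measurable_EFinP; exact: measurable_gamma_kernel.
under eq_integral do rewrite gee0_abs ?lee_fin ?gamma_kernel_ge0//.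
exact: gamma_int_lty.
Qed.

(** After the rotation by s^(-i tau), the real part of the integrand is
    t^(s-1) e^(-t) cos (tau ln (t / s)).  Divided by Gamma (s), the first two
    factors form a density concentrated near t = s: the mean of
    t / s + s / t - 2 is 1 / (s - 1), and t / s + s / t - 2 controls
    1 - cos (tau ln (t / s)) by [cos_ge] and [sqr_ln_le]. *)
Lemma cgamma_lower z : 1 < Re z ->
  rgamma (Re z) * (1 - 2 * Im z ^+ 2 / (Re z - 1)) <= normc (cgamma z).
Proof.
set s := Re z; set tau := Im z => s1; have s0 : 0 < s by apply: lt_trans s1.
have s10 : 0 < s - 1 by rewrite subr_gt0.
pose c : C := cpowR s (0 +i* (- tau)).
have c1 : normc c = 1 by rewrite normc_cpowR//= powRr0.
have [ic cE] :=
  cintegrableZl _ _ c measurableT (cintegrable_cgamma_kernel z s0).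
have -> : normc (cgamma z) = normc (c * cgamma z).
  by rewrite Normc.normcM c1 mul1r.
rewrite -cE; apply: le_trans (le_trans (ler_norm _) (Re_le_normc _)).
rewrite [leRHS]/=.
(* t gamma_kernel s t and t^-1 gamma_kernel s t are the kernels at s + 1 and
   s - 1, so this lower bound of the integrand has an explicit integral. *)
pose low t := (1 + 4 * tau ^+ 2) * gamma_kernel s t
  - (2 * tau ^+ 2 / s) * gamma_kernel (s + 1) t
  - (2 * tau ^+ 2 * s) * gamma_kernel (s - 1) t.
have iZ r a : 0 < a ->
    mu.-integrable setT (EFin \o (fun t => r * gamma_kernel a t)).
  move=> a0; have ia := integrable_gamma_kernel a a0.
  by apply: eq_integrable (integrableZl measurableT r ia).
have iB (f g : R -> R) : mu.-integrable setT (EFin \o f) ->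
    mu.-integrable setT (EFin \o g) ->
    mu.-integrable setT (EFin \o (fun t => f t - g t)).
  by move=> f1 g1; apply: eq_integrable (integrableB measurableT f1 g1).
have RZ r a : 0 < a -> \int[mu]_t (r * gamma_kernel a t) = r * rgamma a.
  move=> a0; rewrite RintegralZl//; exact: integrable_gamma_kernel.
have s2 : 0 < s + 1 by rewrite addr_gt0.
have lowE : \int[mu]_t low t = rgamma s * (1 - 2 * tau ^+ 2 / (s - 1)).
  rewrite RintegralB//; [|by apply: iB; apply: iZ|exact: iZ].
  rewrite RintegralB//; [|exact: iZ|exact: iZ].
  rewrite !RZ// rgamma1D//.
  have -> : rgamma s = (s - 1) * rgamma (s - 1).
    by have := rgamma1D (s - 1) s10; rewrite subrK.
  by field; rewrite !gt_eqF.
rewrite -lowE; apply: le_Rintegral => //.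
- apply: (iB); last exact: iZ. apply: (iB); exact: iZ.
- by case: ic.
move=> t _; rewrite /low /cgamma_kernel.
have [t0|t0] := ltP 0 t; last by rewrite !gamma_kernel_le0// !mulr0 !subr0.
have -> : Re (c * (cpowR t (z - 1) * (expR (- t))%:C)) =
    gamma_kernel s t * cos (tau * ln (t / s)).
  rewrite mulrA /c /cpowR -cexpD /cexp ln_div ?posrE//.
  rewrite !(ReM, ImM, ReD, ImD)/= !(mul0r, mulr0, subr0, addr0, add0r).
  rewrite /gamma_kernel t0 /powR (gt_eqF t0).
  rewrite mulrAC; congr (expR _ * _ * cos _); rewrite -/s -/tau; ring.
have -> : gamma_kernel (s - 1) t = t^-1 * gamma_kernel s t.
  by rewrite -[in RHS](subrK 1 s) gamma_kernel1D mulKf// gt_eqF.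
rewrite gamma_kernel1D; set g := gamma_kernel s t.
have -> : (1 + 4 * tau ^+ 2) * g - 2 * tau ^+ 2 / s * (t * g) -
    2 * tau ^+ 2 * s * (t^-1 * g) =
    g * (1 - tau ^+ 2 * (4 * (t / s + (t / s)^-1 - 2)) / 2).
  by field; rewrite !gt_eqF.
rewrite ler_wpM2l ?gamma_kernel_ge0//; apply: le_trans (cos_ge _).
rewrite exprMn lerD2l lerN2 ler_pM2r ?invr_gt0// ler_wpM2l ?sqr_ge0//.
by apply: sqr_ln_le; rewrite divr_gt0.
Qed.

(** If the integral of x^(p-1) over ]0, 1[ vanished, then by scaling so would
    its integral over ]0, c[, hence over [c, 1[; but near 1 the real part of
    the integrand is positive. *)
Lemma cbeta1_neq0 p : 0 < Re p -> cbeta p 1 != 0.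
Proof.
move=> p0; apply/eqP => J0; pose tau := Im p.
(* On [c, 1[, |tau ln x| <= 1, so that cos (tau ln x) >= 1 / 2. *)
pose c : R := expR (- (`|tau| + 1)^-1).
have tau1 : 0 < `|tau| + 1 by rewrite ltr_wpDl.
have c0 : 0 < c := expR_gt0 _.
have c1 : c < 1 by rewrite expR_lt1 oppr_lt0 invr_gt0.
pose h := cbeta_kernel p 1.
pose hc x : C := if 0 < x < c then cpowR x (p - 1) else 0.
have hE x : h x = if 0 < x < 1 then cpowR x (p - 1) else 0.
  rewrite /h /cbeta_kernel; case: ifP => // _.
  by rewrite subrr /cpowR mulr0 /cexp/= cos0 sin0 expR0 !mulr1.
have mhc : cmeasurable hc.
  apply: cmeasurable_if; last exact: cmeasurable_cst.
    by apply: measurable_and; apply: measurable_fun_ltr.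
  exact: cmeasurable_cpowR.
have ih : cintegrable setT h by apply: cintegrable_cbeta_kernel.
have ihc : cintegrable setT hc.
  apply: cintegrable_normcP => //.
  apply: (@le_lt_trans _ _ (beta_int (Re p) 1)); last first.
    by rewrite beta_intE ?ltry.
  apply: ge0_le_integral => //.
  - by move=> x _; rewrite lee_fin normc_ge0.
  - by apply/measurable_EFinP; exact: measurable_normc.
  - by apply/measurable_EFinP; exact: measurable_beta_kernel.
  move=> x _; rewrite lee_fin -(normc_cbeta_kernel p 1) -/h hE /hc.
  case: ifP => [/andP[x0 xc]|_]; last by rewrite Normc.normc0 normc_ge0.
  by rewrite x0 (lt_trans xc c1).
have hc0 : cintegral setT hc = 0.
  rewrite (cintegral_affine c 0)//.
  rewrite (_ : cintegral _ _ = cpowR c (p - 1) * cbeta p 1); last first.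
    rewrite -(cintegrableZl _ _ _ measurableT ih).2; apply: eq_cintegral => x _.
    rewrite addr0 hE /hc pmulr_rgt0// gtr_pMr//.
    case: ifP => [/andP[x0 _]|_]; last by rewrite mulr0.
    by rewrite cpowRM.
  by rewrite J0 !mulr0.
have : \int[mu]_x (Re (h x) - Re (hc x)) = 0.
  rewrite RintegralB//; [|by case: ih|by case: ihc].
  have -> : \int[mu]_x Re (h x) = Re (cbeta p 1) by [].
  have -> : \int[mu]_x Re (hc x) = Re (cintegral setT hc) by [].
  by rewrite hc0 J0 subr0.
have diffE x : Re (h x) - Re (hc x) =
    if c <= x < 1 then Re (cpowR x (p - 1)) else 0.
  rewrite hE /hc; have [xc|xc] := ltP x c.
    rewrite (lt_trans xc c1) !andbT; case: ifP => _; rewrite subrr//.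
  by rewrite (lt_le_trans c0 xc)/= subr0; case: ifP.
have pos x : c <= x < 1 -> 0 < Re (cpowR x (p - 1)).
  move=> /andP[cx x1]; have x0 : 0 < x by apply: lt_le_trans cx.
  rewrite /cpowR /cexp ReM/= mul0r subr0 mulr_gt0 ?expR_gt0//.
  rewrite ImM/= mul0r addr0 ImD/= oppr0 addr0 -/tau.
  apply: lt_le_trans (cos_ge _).
  have : `|ln x * tau| <= 1.
    rewrite normrM ler0_norm ?ln_le0 ?(ltW x1)//.
    have : - ln x <= (`|tau| + 1)^-1.
      by rewrite lerNl -[leLHS]expRK ler_ln ?posrE.
    move=> lx; apply: (@le_trans _ _ ((`|tau| + 1)^-1 * (`|tau| + 1))).
      by apply: ler_pM => //; rewrite ?oppr_ge0 ?ln_le0 ?(ltW x1)// lerDl.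
    by rewrite mulVf// gt_eqF.
  move=> le1; have : (ln x * tau) ^+ 2 <= 1.
    by rewrite -real_normK ?num_real// expr_le1.
  lra.
move=> D0.
case: (ih) (ihc) => /measurable_int/measurable_EFinP mh _.
case=> /measurable_int/measurable_EFinP mhc1 _.
have mD : measurable_fun setT (fun x => Re (h x) - Re (hc x)).
  exact: measurable_funB.
have D_ge0 x : 0 <= Re (h x) - Re (hc x).
  by rewrite diffE; case: ifP => // /pos/ltW.
have : (0 < \int[mu]_(x in `]c, 1%R[) (Re (h x) - Re (hc x))%:E)%E.
  apply: integral_itv_gt0 => //; first exact: measurable_funTS.
  by move=> t /andP[ct t1]; rewrite diffE (ltW ct) t1 pos// (ltW ct).
apply/negP; rewrite -leNgt.
apply: (@le_trans _ _ (\int[mu]_x (Re (h x) - Re (hc x))%:E)%E).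
  apply: ge0_subset_integral => //; first exact/measurable_EFinP.
  by move=> x _; rewrite lee_fin.
have iD : mu.-integrable setT (fun x => (Re (h x) - Re (hc x))%:E).
  case: (ih) (ihc) => h1 _ [h2 _].
  by apply: eq_integrable (integrableB measurableT h1 h2).
suff -> : (\int[mu]_x (Re (h x) - Re (hc x))%:E)%E = 0%E by [].
transitivity (\int[mu]_x (Re (h x) - Re (hc x)))%:E; last by rewrite D0.
by rewrite /Rintegral fineK//; exact: (integrable_fin_num measurableT iD).
Qed.

(** Gamma (p) Gamma (1) = B (p, 1) Gamma (p + 1) carries a zero at p to p + n
    for every n, where the lower bound excludes it. *)
Lemma cgamma_neq0 z : 0 < Re z -> cgamma z != 0.
Proof.
move=> z0; apply/eqP => Gz0.
have ReDn n : Re (z + n%:R) = Re z + n%:R.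
  by rewrite ReD -(rmorph_nat (real_complex R)).
have ImDn n : Im (z + n%:R) = Im z.
  by rewrite ImD -(rmorph_nat (real_complex R))/= addr0.
have Gn n : cgamma (z + n%:R) = 0.
  elim: n => [|n IH]; first by rewrite addr0.
  have zn0 : 0 < Re (z + n%:R) by rewrite ReDn ltr_wpDr.
  have := cgamma_mul _ 1 zn0 ltr01; rewrite IH mul0r => /esym/eqP.
  rewrite mulf_eq0 (negPf (cbeta1_neq0 _ zn0))/= => /eqP.
  by rewrite -addrA -natr1.
pose n := (Num.truncn (1 + 2 * Im z ^+ 2)).+1.
have n_gt : 1 + 2 * Im z ^+ 2 < n%:R by exact: truncnS_gt.
have tau0 : 0 <= 2 * Im z ^+ 2 by rewrite mulr_ge0 ?sqr_ge0.
have z1 : 1 < Re (z + n%:R) by rewrite ReDn; lra.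
have := cgamma_lower _ z1; rewrite Gn Normc.normc0 ImDn ReDn.
apply/negP; rewrite -ltNge; apply: mulr_gt0.
  by apply: rgamma_gt0; lra.
by rewrite subr_gt0 ltr_pdivrMr; lra.
Qed.

(** [cgamma_lower] gives the constant 2 for large m; the finitely many other
    ratios are finite because Gamma does not vanish. *)
Lemma rgamma_le_cgamma z (a : R) : 0 < Re z -> 0 < a ->
  exists2 K : R, 0 < K & forall m : nat,
    rgamma (Re z + a * m%:R) <= K * normc (cgamma (z + (a * m%:R)%:C)).
Proof.
move=> z0 a0; set tau := Im z.
pose zz (m : nat) := z + (a * m%:R)%:C.
have Rzz m : Re (zz m) = Re z + a * m%:R by rewrite ReD.
have Izz m : Im (zz m) = tau by rewrite ImD addr0.
have am0 m : 0 <= a * m%:R by rewrite mulr_ge0// ltW.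
have zz0 m : 0 < Re (zz m) by rewrite Rzz ltr_wpDr.
have n0 m : 0 < normc (cgamma (zz m)) by rewrite normc_gt0 cgamma_neq0.
pose N := (Num.truncn ((1 + 4 * tau ^+ 2) / a)).+1.
pose r m := rgamma (Re (zz m)) / normc (cgamma (zz m)).
have r0 m : 0 <= r m by rewrite divr_ge0 ?ltW ?rgamma_gt0.
exists (2 + \sum_(k < N) r k).
  by rewrite ltr_wpDr// sumr_ge0.
move=> m; rewrite -Rzz -(ler_pdivrMr _ _ (n0 m)) -/(r m).
have [mN|Nm] := ltnP m N.
  rewrite (bigD1 (Ordinal mN))//= addrCA lerDl addr_ge0// sumr_ge0//.
apply: (@le_trans _ _ 2); last by rewrite lerDl sumr_ge0.
rewrite /r ler_pdivrMr//.
have tau0 : 0 <= tau ^+ 2 by exact: sqr_ge0.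
have ham : 1 + 4 * tau ^+ 2 < a * m%:R.
  rewrite [ltRHS]mulrC -ltr_pdivrMr//; apply: (lt_le_trans (truncnS_gt _)).
  by rewrite ler_nat.
have zz1 : 1 < Re (zz m) by rewrite Rzz; lra.
have := cgamma_lower _ zz1; rewrite Izz.
set G := normc _; set g := rgamma _ => gG.
have g0 : 0 < g by apply: rgamma_gt0.
have : g * 2^-1 <= G.
  apply: le_trans gG; rewrite ler_pM2l//.
  suff : 2 * tau ^+ 2 / (Re (zz m) - 1) <= 2^-1 by lra.
  by rewrite ler_pdivrMr ?subr_gt0// Rzz; lra.
lra.
Qed.

Lemma GammaE z : 0 < Re z -> Gamma z = cgamma z.
Proof.
move=> z0; rewrite /Gamma /Gamma_shift z0 big_ord0 divr1 addr0.
exact: Euler_GammaE.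
Qed.

End nonvanishing.

(** * Termwise integration of series *)

Section termwise.
Context {R : realType}.
Local Notation C := R[i].
Local Notation mu := (@lebesgue_measure R).

Definition abs_summable (g : nat -> R) := (\sum_(0 <= k <oo) `|g k|%:E < +oo)%E.

Lemma abs_summable_le (g h : nat -> R) : (forall k, `|g k| <= `|h k|) ->
  abs_summable h -> abs_summable g.
Proof.
move=> gh; apply: le_lt_trans; apply: lee_nneseries => k _; rewrite lee_fin//.
Qed.

Lemma abs_summable_cvg (g : nat -> R) : abs_summable g ->
  cvgn [normed series g].
Proof.
move=> gs; apply: nondecreasing_is_cvgn.
  by apply: nondecreasing_series => *; exact: normr_ge0.
exists (fine (\sum_(0 <= k <oo) `|g k|%:E)%E) => _ [n _ <-].
rewrite -lee_fin fineK; last by rewrite ge0_fin_numE// nneseries_ge0.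
rewrite /series /= -sumEFin; exact: nneseries_lim_ge.
Qed.

Lemma abs_summable_norm_le (g : nat -> R) (a : R) :
  (\sum_(0 <= k <oo) `|g k|%:E <= a%:E)%E -> `|limn (series g)| <= a.
Proof.
move=> ga; have gs : abs_summable g by apply: le_lt_trans ga _; rewrite ltry.
have cg := abs_summable_cvg _ gs.
apply: le_trans (lim_series_norm cg) _.
apply: limr_le => //; apply: nearW => n.
rewrite -lee_fin; apply: le_trans ga.
rewrite /series /= -sumEFin; exact: nneseries_lim_ge.
Qed.

(** Dominated convergence, with the sum of the g k as the dominating function:
    it is integrable because the sum and the integral of nonnegative functions
    commute. *)
Lemma Rintegral_series (f g : nat -> R -> R) :
  (forall k, measurable_fun setT (f k)) ->
  (forall k, measurable_fun setT (g k)) ->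
  (forall k t, `|f k t| <= g k t) ->
  (forall t, abs_summable (g ^~ t)) ->
  (\sum_(0 <= k <oo) \int[mu]_t (g k t)%:E < +oo)%E ->
  mu.-integrable setT (fun t => (limn (series (f ^~ t)))%:E) /\
  \int[mu]_t limn (series (f ^~ t)) = limn (series (fun k => \int[mu]_t f k t)).
Proof.
move=> mf mg fg gs goo.
have g0 k t : (0 <= (g k t)%:E)%E by rewrite lee_fin; apply: le_trans (fg k t).
have mEg k : measurable_fun setT (EFin \o g k) by exact/measurable_EFinP.
pose G t : \bar R := (\sum_(0 <= k <oo) (g k t)%:E)%E.
have G0 t : (0 <= G t)%E by apply: nneseries_ge0.
have ig : mu.-integrable setT G.
  apply/integrableP; split.
    by apply: (ge0_emeasurable_sum (P := xpredT)) => // k _; exact: mEg.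
  under eq_integral do rewrite gee0_abs//.
  rewrite integral_nneseries//.
have ifk k : mu.-integrable setT (EFin \o f k).
  apply: le_integrable ig => //; first by apply/measurable_EFinP; exact: mf.
  move=> t _; rewrite [leRHS]gee0_abs//.
  apply: (@le_trans _ _ (g k t)%:E); first by rewrite lee_fin.
  by rewrite /G (nneseriesD1 (n := k))// leeDl// nneseries_ge0.
have cf t : cvgn (series (f ^~ t)).
  apply: normed_cvg; apply: abs_summable_cvg.
  apply: abs_summable_le _ (gs t) => k.
  by rewrite (ger0_norm (le_trans _ (fg k t))).
have mser n : measurable_fun setT (fun t => series (f ^~ t) n).
  by apply: measurable_sum => k; exact: mf.
have mlim : measurable_fun setT (fun t => limn (series (f ^~ t))).
  by apply: (measurable_fun_cvg (h := fun n t => series (f ^~ t) n)).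
have [iF _ cF] : [/\ mu.-integrable setT (fun t => (limn (series (f ^~ t)))%:E),
    (\int[mu]_t `|(series (f ^~ t) n)%:E - (limn (series (f ^~ t)))%:E|)%E
      @[n --> \oo] --> 0%E &
    (\int[mu]_t (series (f ^~ t) n)%:E)%E @[n --> \oo] -->
      (\int[mu]_t (limn (series (f ^~ t)))%:E)%E].
  apply: (@dominated_convergence _ _ _ mu setT measurableT
    (fun n t => (series (f ^~ t) n)%:E) _ G) => //.
  - by move=> n; apply/measurable_EFinP; exact: mser.
  - by apply/measurable_EFinP; exact: mlim.
  - by apply: aeW => t _; apply: cvg_EFin; [exact: nearW|exact: cf].
  - apply: aeW => t n _; rewrite /= /series /=.
    apply: (@le_trans _ _ (\sum_(0 <= k < n) g k t)%:E).
      rewrite lee_fin; apply: (le_trans (ler_norm_sum _ _ _)).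
      by apply: ler_sum => k _.
    by rewrite /G -sumEFin; apply: nneseries_lim_ge.
split => //.
have sumE n : (\int[mu]_t (series (f ^~ t) n)%:E)%E =
    (series (fun k => \int[mu]_t f k t) n)%:E.
  rewrite /series /=; under eq_integral do rewrite -sumEFin.
  rewrite integral_sum// -sumEFin; apply: eq_bigr => k _.
  rewrite /Rintegral fineK//.
  exact: (integrable_fin_num measurableT (ifk k)).
apply/esym/cvg_lim => //.
have := cF; under eq_fun do rewrite sumE.
rewrite -[X in _ --> X](fineK (integrable_fin_num measurableT iF)).
by move/fine_cvgP => [_].
Qed.

End termwise.

Section complex_series.
Context {R : realType}.
Local Notation C := R[i].
Local Notation mu := (@lebesgue_measure R).
Implicit Types u : nat -> C.

Definition csummable u := (\sum_(0 <= k <oo) (normc (u k))%:E < +oo)%E.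

Lemma csummable_Re u : csummable u -> abs_summable (fun k => Re (u k)).
Proof.
apply: le_lt_trans; apply: lee_nneseries => k *; rewrite lee_fin//.
exact: Re_le_normc.
Qed.

Lemma csummable_Im u : csummable u -> abs_summable (fun k => Im (u k)).
Proof.
apply: le_lt_trans; apply: lee_nneseries => k *; rewrite lee_fin//.
exact: Im_le_normc.
Qed.

Lemma eq_cseries u v : u =1 v -> cseries u = cseries v.
Proof. by move=> /funext ->. Qed.

Lemma cseriesZ (c : C) u : csummable u ->
  cseries (fun k => c * u k) = c * cseries u.
Proof.
move=> su; have cR := normed_cvg (abs_summable_cvg _ (csummable_Re _ su)).
have cI := normed_cvg (abs_summable_cvg _ (csummable_Im _ su)).
have E (f g : nat -> R) (r s : R) : cvgn (series f) -> cvgn (series g) ->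
    limn (series (fun k => r * f k + s * g k)) =
    r * limn (series f) + s * limn (series g).
  move=> cf cg; rewrite (_ : (fun _ => _) = (r *: f) + (s *: g)); last first.
    by apply/funext.
  rewrite lim_seriesD; [|exact: is_cvg_seriesZ|exact: is_cvg_seriesZ].
  by rewrite !lim_seriesZ.
apply: eq_ReIm; rewrite ?ReM ?ImM /cseries/=.
  rewrite -mulNr -E//; congr (limn (series _)); apply/funext => k.
  by rewrite ReM mulNr.
by rewrite -E//; congr (limn (series _)); apply/funext => k; rewrite ImM.
Qed.

Lemma normc_cseries_le u :
  ((normc (cseries u))%:E <= 2%:E * \sum_(0 <= k <oo) (normc (u k))%:E)%E.
Proof.
set S := (\sum_(0 <= k <oo) _)%E.
have S0 : (0 <= S)%E.
  by apply: nneseries_ge0 => k *; rewrite lee_fin normc_ge0.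
have [Soo|] := ltP S +oo%E; last first.
  by rewrite leye_eq => /eqP ->; rewrite gt0_muley ?lte_fin// leey.
have SE : S = (fine S)%:E by rewrite fineK// ge0_fin_numE.
rewrite SE -EFinM lee_fin; apply: (le_trans (normc_le_ReIm _)).
rewrite mulr_natl mulr2n; apply: lerD => /=; apply: abs_summable_norm_le.
  by rewrite -SE /S; apply: lee_nneseries => k *; rewrite lee_fin// Re_le_normc.
by rewrite -SE /S; apply: lee_nneseries => k *; rewrite lee_fin// Im_le_normc.
Qed.

Lemma cintegral_series (f : nat -> R -> C) :
  (forall k, cmeasurable (f k)) ->
  (forall t, csummable (f ^~ t)) ->
  (\sum_(0 <= k <oo) \int[mu]_t (normc (f k t))%:E < +oo)%E ->
  cintegrable setT (fun t => cseries (f ^~ t)) /\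
  cintegral setT (fun t => cseries (f ^~ t)) =
    cseries (fun k => cintegral setT (f k)).
Proof.
move=> mf sf foo.
have sn t : abs_summable (fun k => normc (f k t)).
  apply: le_lt_trans (sf t); apply: lee_nneseries => k * //.
  by rewrite lee_fin ger0_norm ?normc_ge0.
have mn k := measurable_normc _ _ _ (mf k).
have [iR eR] := Rintegral_series (fun k t => Re (f k t))
  (fun k t => normc (f k t)) (fun k => (mf k).1) mn
  (fun k t => Re_le_normc _) sn foo.
have [iI eI] := Rintegral_series (fun k t => Im (f k t))
  (fun k t => normc (f k t)) (fun k => (mf k).2) mn
  (fun k t => Im_le_normc _) sn foo.
by split; [split|rewrite /cintegral/= eR eI].
Qed.

Lemma csummable2E (t : nat -> nat -> C) : csummable2 t =
  (\sum_(0 <= m <oo) \sum_(0 <= n <oo) (normc (t m n))%:E < +oo)%E.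
Proof.
have t0 m n : (0 <= (normc (t m n))%:E)%E by rewrite lee_fin normc_ge0.
rewrite nneseries_esumT; last by move=> m; apply: nneseries_ge0.
under eq_esum => m _ do rewrite nneseries_esumT//.
rewrite esum_esum// (_ : _ `*`` _ = setT); last by apply/seteqP; split.
rewrite /csummable2 /summable; congr (is_true (_ < _)%E).
by apply: eq_esum => -[m n] _ /=; rewrite ger0_norm ?normc_ge0.
Qed.

Lemma csummable2_le (K : R) (t u : nat -> nat -> C) : 0 <= K ->
  (forall m n, normc (u m n) <= K * normc (t m n)) ->
  csummable2 t -> csummable2 u.
Proof.
have p0 (v : nat -> nat -> C) m n : (0 <= (normc (v m n))%:E)%E.
  by rewrite lee_fin normc_ge0.
have q0 (v : nat -> nat -> C) m : (0 <= \sum_(0 <= n <oo) (normc (v m n))%:E)%E.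
  exact: nneseries_ge0.
move=> K0 ut; rewrite !csummable2E => st.
apply: (@le_lt_trans _ _
    (\sum_(0 <= m <oo) (K%:E * \sum_(0 <= n <oo) (normc (t m n))%:E))%E).
  apply: lee_nneseries => // m _; rewrite -nneseriesZl//.
  by apply: lee_nneseries => // n _; rewrite -EFinM lee_fin.
by rewrite nneseriesZl//; apply: lte_mul_pinfty.
Qed.

Lemma csummable2_row (t : nat -> nat -> C) m : csummable2 t -> csummable (t m).
Proof.
rewrite csummable2E; apply: le_lt_trans.
have q0 k : (0 <= \sum_(0 <= n <oo) (normc (t k n))%:E)%E.
  by apply: nneseries_ge0 => n *; rewrite lee_fin normc_ge0.
by rewrite [leRHS](nneseriesD1 (n := m))// leeDl// nneseries_ge0.
Qed.

End complex_series.

(** * Bounds on Beta integrals *)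

Section beta_bounds.
Context {R : realType}.
Local Notation C := R[i].
Local Notation mu := (@lebesgue_measure R).

Lemma cbetaE (p q : C) : 0 < Re p -> 0 < Re q ->
  cbeta p q = cgamma p * cgamma q / cgamma (p + q).
Proof.
move=> p0 q0; rewrite cgamma_mul// mulfK//.
by apply: cgamma_neq0; rewrite ReD addr_gt0.
Qed.

Lemma cbeta_neq0 (p q : C) : 0 < Re p -> 0 < Re q -> cbeta p q != 0.
Proof.
move=> p0 q0; have pq0 : 0 < Re (p + q) by rewrite ReD addr_gt0.
rewrite cbetaE// mulf_neq0 ?invr_eq0 ?cgamma_neq0//.
by rewrite mulf_neq0 ?cgamma_neq0.
Qed.

Lemma normc_cgamma_le (z : C) :
  0 < Re z -> normc (cgamma z) <= 2 * rgamma (Re z).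
Proof.
move=> z0; apply: normc_cintegral_le.
- exact: cintegrable_cgamma_kernel.
- exact: integrable_gamma_kernel.
- by move=> t; rewrite normc_cgamma_kernel.
Qed.

(** The cancellation in the complex Beta integral stays bounded as p moves to
    the right along a horizontal half-line: by Euler's formula only
    |Gamma (p + a m)| has to be bounded from below. *)
Lemma beta_le_cbeta (p q : C) (a : R) : 0 < Re p -> 0 < Re q -> 0 < a ->
  exists2 K : R, 0 < K & forall m : nat,
    (beta_int (Re p + a * m%:R) (Re q) <=
     (K * normc (cbeta (p + (a * m%:R)%:C) q))%:E)%E.
Proof.
move=> p0 q0 a0; have [K0 K00 HK] := rgamma_le_cgamma p a p0 a0.
have rq0 := rgamma_gt0 _ q0.
have nq0 : 0 < normc (cgamma q) by rewrite normc_gt0 cgamma_neq0.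
exists (2 * K0 * rgamma (Re q) / normc (cgamma q)).
  by rewrite divr_gt0// mulr_gt0// mulr_gt0.
move=> m; set p' := p + _.
have Rp' : Re p' = Re p + a * m%:R by rewrite ReD.
have p'0 : 0 < Re p' by rewrite Rp' ltr_wpDr// mulr_ge0// ltW.
have pq0 : 0 < Re (p' + q) by rewrite ReD addr_gt0.
have npq0 : 0 < normc (cgamma (p' + q)) by rewrite normc_gt0 cgamma_neq0.
rewrite -Rp' beta_intE// lee_fin cbetaE// !Normc.normcM Normc.normcV.
have := HK m; rewrite -Rp' -/p' => HKm.
have := normc_cgamma_le _ pq0; rewrite ReD => Gle.
have rpq0 : 0 < rgamma (Re p' + Re q) by rewrite rgamma_gt0// addr_gt0.
rewrite ler_pdivrMr//.
move: HKm Gle nq0 npq0 rpq0 rq0; have := normc_ge0 (cgamma p').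
move: (normc (cgamma p')) (normc (cgamma (p' + q))) (normc (cgamma q)).
move: (rgamma (Re p')) (rgamma (Re p' + Re q)) (rgamma (Re q)).
move=> r1 r3 r2 G1 G3 G2 G10 HKm Gle nq0 npq0 rpq0 rq0.
have -> : 2 * K0 * r2 / G2 * (G1 * G2 / G3) * r3 =
    (K0 * G1 * r2) * (2 * r3 / G3).
  by field; rewrite !gt_eqF.
have KG0 : 0 <= K0 * G1 * r2 by rewrite mulr_ge0 ?(ltW rq0)// mulr_ge0// ltW.
have r3G3 : 1 <= 2 * r3 / G3 by rewrite ler_pdivlMr// mul1r.
apply: (@le_trans _ _ (K0 * G1 * r2)); first by rewrite ler_pM2r.
by rewrite ler_peMr.
Qed.

(** Keep only the part of the integral over ]x, 1[, where the factor t^l is at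
    least x^l. *)
Lemma powR_le_beta (x a b : R) : 0 < x < 1 -> 0 < a -> 0 < b ->
  exists2 k : R, 0 < k & forall l, 0 <= l ->
    ((x `^ l)%:E <= k%:E * beta_int (a + l) b)%E.
Proof.
move=> /andP[x0 x1] a0 b0.
pose I := (\int[mu]_(t in `]x, 1%R[) (beta_kernel a b t)%:E)%E.
have mk c : measurable_fun setT (beta_kernel c b).
  exact: measurable_beta_kernel.
have k0 c t : (0 <= (beta_kernel c b t)%:E)%E.
  by rewrite lee_fin beta_kernel_ge0.
have mEk c : measurable_fun setT (EFin \o beta_kernel c b).
  by apply/measurable_EFinP; exact: mk.
have I0 : (0 < I)%E.
  apply: integral_itv_gt0 => //; first exact: measurable_funTS.
  move=> t /andP[xt t1]; rewrite /beta_kernel (lt_trans x0 xt) t1/=.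
  by rewrite mulr_gt0// powR_gt0 ?subr_gt0// (lt_trans x0 xt).
have sub c :
    (\int[mu]_(t in `]x, 1%R[) (beta_kernel c b t)%:E <= beta_int c b)%E.
  by apply: ge0_subset_integral => //; exact: mEk.
have Ifin : I = (fine I)%:E.
  rewrite fineK// ge0_fin_numE ?(ltW I0)//; apply: le_lt_trans (sub a) _.
  by rewrite beta_intE// ltry.
have fI0 : 0 < fine I by rewrite -lte_fin -Ifin.
exists (fine I)^-1; first by rewrite invr_gt0.
move=> l l0; rewrite -(@lee_pmul2l _ (fine I)%:E) ?lte_fin//.
rewrite [leRHS]muleA -[X in (_ <= X * _)%E]EFinM divff ?gt_eqF// mul1e.
apply: le_trans (sub (a + l)); rewrite -Ifin muleC /I.
rewrite -ge0_integralZl//; last 2 first.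
- by apply: measurable_funTS; exact: mEk.
- by rewrite lee_fin powR_ge0.
apply: ge0_le_integral => //.
- by move=> t _; rewrite mule_ge0// lee_fin powR_ge0.
- by apply: measurable_funTS; apply: measurable_funeM; exact: mEk.
- by apply: measurable_funTS; exact: mEk.
move=> t /=; rewrite in_itv/= => /andP[xt t1]; have t0 := lt_trans x0 xt.
rewrite -EFinM lee_fin /beta_kernel t0 t1/= mulrA.
rewrite ler_wpM2r ?powR_ge0//.
have -> : a + l - 1 = l + (a - 1) by ring.
rewrite (@powRD _ t l (a - 1)) ?(gt_eqF t0) ?implybT//.
rewrite ler_wpM2r ?powR_ge0// ge0_ler_powR// ?nnegrE ltW//.
Qed.

End beta_bounds.

(** * The integral formula *)

Section pochhammer.
Context {R : realType}.
Local Notation C := R[i].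

Lemma PochhammerE (g : C) (l : R) : 0 < Re g -> 0 <= l ->
  Pochhammer g l = cgamma (g + l%:C) / cgamma g.
Proof.
move=> g0 l0; rewrite /Pochhammer /Gamma_pole.
have -> : (- Re g \is a Num.nat) = false.
  by apply/negP => /Num.Theory.natr_ge0; rewrite oppr_ge0 leNgt g0.
by rewrite andbF/= !GammaE// ReD ltr_wpDr.
Qed.

(** The ratio of the two Pochhammer symbols is, up to a factor independent
    of l, Euler's beta integral. *)
Lemma Pochhammer_ratio (g mu : C) (l : R) :
  0 < Re g -> Re g < Re mu -> 0 <= l ->
  Pochhammer g l =
  Gamma mu / (Gamma g * Gamma (mu - g)) * cbeta (g + l%:C) (mu - g) *
  Pochhammer mu l.
Proof.
move=> g0 gmu l0; have mu0 : 0 < Re mu by apply: lt_trans gmu.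
have d0 : 0 < Re (mu - g) by rewrite ReB subr_gt0.
have gl0 : 0 < Re (g + l%:C) by rewrite ReD ltr_wpDr.
have mul0 : 0 < Re (mu + l%:C) by rewrite ReD ltr_wpDr.
rewrite !PochhammerE// !GammaE// cbetaE//.
have -> : g + l%:C + (mu - g) = mu + l%:C by ring.
move: (cgamma_neq0 _ g0) (cgamma_neq0 _ mu0).
move: (cgamma_neq0 _ d0) (cgamma_neq0 _ mul0).
move: (cgamma g) (cgamma mu) (cgamma (mu - g)) (cgamma (mu + l%:C)).
by move=> Gg Gmu Gd Gmul *; field; apply/and4P.
Qed.

End pochhammer.

(* The hypothesis is absolute convergence of the left-hand series.  The first
   two conjuncts say that the right-hand side is meaningful: its series
   converges absolutely for 0 < xi < 1 and its integrand is Lebesgue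
   integrable; the third one is the integral formula. *)
Theorem mainTheorem2 (R : realType)
    (g1 g2 g3 d1 d2 d3 x y mu : R[i]) (a1 a2 a3 a4 b1 b2 b3 b4 : R)
    (ha1 : 0 < a1) (ha2 : 0 < a2) (ha3 : 0 < a3) (ha4 : 0 < a4)
    (hb1 : 0 < b1) (hb2 : 0 < b2) (hb3 : 0 < b3) (hb4 : 0 < b4)
    (hg2 : 0 < Re g2) (hmu : Re g2 < Re mu)
    (hconv : D1_summable g1 a1 b1 g2 a2 g3 b2 d1 a3 b3 d2 a4 d3 b4 x y) :
  [/\ forall xi : R, 0 < xi < 1 ->
        D1_summable g1 a1 b1 mu a2 g3 b2 d1 a3 b3 d2 a4 d3 b4
          (x * (xi `^ a2)%:C) y,
      cintegrable `]0, 1[ (fun xi : R =>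
        cpowR xi (g2 - 1) * cpowR (1 - xi) (mu - g2 - 1)
        * D1 g1 a1 b1 mu a2 g3 b2 d1 a3 b3 d2 a4 d3 b4
            (x * (xi `^ a2)%:C) y)
    & D1 g1 a1 b1 g2 a2 g3 b2 d1 a3 b3 d2 a4 d3 b4 x y =
      Gamma mu / (Gamma g2 * Gamma (mu - g2)) *
      cintegral `]0, 1[ (fun xi : R =>
        cpowR xi (g2 - 1) * cpowR (1 - xi) (mu - g2 - 1)
        * D1 g1 a1 b1 mu a2 g3 b2 d1 a3 b3 d2 a4 d3 b4
            (x * (xi `^ a2)%:C) y)].
Proof.
set t := D1_term g1 a1 b1 g2 a2 g3 b2 d1 a3 b3 d2 a4 d3 b4 x y.
set u := D1_term g1 a1 b1 mu a2 g3 b2 d1 a3 b3 d2 a4 d3 b4 x y.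
pose l (m : nat) := a2 * m%:R.
pose w (xi : R) :=
  D1_term g1 a1 b1 mu a2 g3 b2 d1 a3 b3 d2 a4 d3 b4 (x * (xi `^ a2)%:C) y.
pose q := mu - g2.
pose kappa := Gamma mu / (Gamma g2 * Gamma q).
pose B m := cbeta (g2 + (l m)%:C) q.
have mu0 : 0 < Re mu by apply: lt_trans hmu.
have q0 : 0 < Re q by rewrite ReB subr_gt0.
have l0 m : 0 <= l m by rewrite mulr_ge0// ltW.
have gl0 m : 0 < Re (g2 + (l m)%:C) by rewrite ReD ltr_wpDr//; exact: l0.
have kappa0 : kappa != 0.
  rewrite /kappa !GammaE// mulf_neq0 ?invr_eq0 ?cgamma_neq0//.
  by rewrite mulf_neq0 ?cgamma_neq0.
have B0 m : B m != 0 by apply: cbeta_neq0.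
have wE xi m n : w xi m n = (xi `^ l m)%:C * u m n.
  rewrite /w /u /D1_term exprMn -rmorphXn/= /l powRrM powR_mulrn ?powR_ge0//.
  ring.
have tE m n : t m n = kappa * B m * u m n.
  rewrite /t /u /D1_term [Pochhammer g2 _](Pochhammer_ratio g2 mu)//;
    last exact: l0.
  by rewrite -/q -/kappa -/(l m) -/(B m); ring.
have uE m n : u m n = (kappa * B m)^-1 * t m n.
  by rewrite tE mulKf// mulf_neq0.
have nk0 : 0 < normc kappa by rewrite normc_gt0.
have nB0 m : 0 < normc (B m) by rewrite normc_gt0.
have su m : csummable (u m).
  have tm := csummable2_row t m hconv.
  apply: (@le_lt_trans _ _ ((normc (kappa * B m)^-1)%:E *
      \sum_(0 <= n <oo) (normc (t m n))%:E)%E).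
    rewrite -nneseriesZl//; last by move=> n _; rewrite lee_fin normc_ge0.
    apply: lee_nneseries => [n *|n _]; first by rewrite lee_fin normc_ge0.
    by rewrite uE Normc.normcM EFinM.
  by apply: lte_mul_pinfty => //; rewrite lee_fin normc_ge0.
(* Since xi enters through m alone, A m is the coefficient of xi^(a2 m) in the
   series under the integral sign. *)
pose A m := cseries (u m).
(* |t m n| = |kappa| |B m| |u m n|, so absolute convergence of the left-hand
   series bounds the sum of |A m| against any weight dominated by |B m|. *)
have sA (k : nat -> R) (K : R) : 0 <= K -> (forall m, 0 <= k m) ->
    (forall m, k m <= K * normc (B m)) ->
    (\sum_(0 <= m <oo) (normc (A m) * k m)%:E < +oo)%E.
  move=> K0 k0 kB; move: hconv; rewrite /D1_summable csummable2E -/t => st.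
  apply: (@le_lt_trans _ _ ((2 * K / normc kappa)%:E *
      \sum_(0 <= m <oo) \sum_(0 <= n <oo) (normc (t m n))%:E)%E); last first.
    apply: lte_mul_pinfty => //; rewrite lee_fin.
    by rewrite divr_ge0 ?mulr_ge0 ?normc_ge0.
  have s0 m : (0 <= \sum_(0 <= n <oo) (normc (t m n))%:E)%E.
    by apply: nneseries_ge0 => n *; rewrite lee_fin normc_ge0.
  rewrite -nneseriesZl//.
  apply: lee_nneseries => [m *|m _].
    by rewrite lee_fin mulr_ge0 ?normc_ge0.
  have tmE : (\sum_(0 <= n <oo) (normc (t m n))%:E =
      (normc kappa * normc (B m))%:E * \sum_(0 <= n <oo) (normc (u m n))%:E)%E.
    rewrite -nneseriesZl//; last by move=> n _; rewrite lee_fin normc_ge0.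
    by apply: eq_eseriesr => n _; rewrite tE !Normc.normcM EFinM.
  rewrite tmE muleA -EFinM.
  have -> : 2 * K / normc kappa * (normc kappa * normc (B m)) =
      K * normc (B m) * 2 by field; rewrite gt_eqF.
  rewrite [(K * normc (B m) * 2)%:E]EFinM -muleA.
  apply: (@le_trans _ _ ((K * normc (B m))%:E * (normc (A m))%:E)%E).
    by rewrite -EFinM lee_fin mulrC ler_wpM2r ?normc_ge0.
  apply: lee_wpmul2l; last exact: normc_cseries_le.
  by rewrite lee_fin mulr_ge0 ?normc_ge0.
(* The weight xi^(a2 m): pointwise convergence for 0 < xi < 1. *)
have xiB xi : 0 < xi < 1 -> exists2 K : R, 0 <= K &
    forall m, xi `^ l m <= K * normc (B m).
  move=> xi01; have [k k0 Hk] := powR_le_beta xi (Re g2) (Re q) xi01 hg2 q0.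
  have [K K0 HK] := beta_le_cbeta g2 q a2 hg2 q0 ha2.
  exists (k * K); first by rewrite mulr_ge0 ?ltW.
  move=> m; rewrite -lee_fin; apply: le_trans (Hk _ (l0 m)) _.
  by rewrite -mulrA EFinM lee_wpmul2l// ?lee_fin ?(ltW k0)//; exact: HK.
pose f m xi := A m * cbeta_kernel (g2 + (l m)%:C) q xi.
pose W xi := cpowR xi (g2 - 1) * cpowR (1 - xi) (mu - g2 - 1) * cseries2 (w xi).
have WE xi : 0 < xi < 1 -> W xi = cseries (f ^~ xi).
  move=> xi01; have [K K0 xiK] := xiB _ xi01.
  have D1E : cseries2 (w xi) = cseries (fun m => (xi `^ l m)%:C * A m).
    apply: eq_cseries => m; rewrite -cseriesZ//.
    by apply: eq_cseries => n; rewrite wE.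
  rewrite /W D1E -cseriesZ; last first.
    rewrite /csummable; under eq_eseriesr => m _.
      rewrite Normc.normcM normc_real ger0_norm ?powR_ge0// mulrC.
      over.
    by apply: (sA _ K) => // m; rewrite powR_ge0.
  apply: eq_cseries => m; rewrite /f /cbeta_kernel xi01 -/q.
  have -> : g2 + (l m)%:C - 1 = (g2 - 1) + (l m)%:C by ring.
  case/andP: xi01 => xi0 _; rewrite (cpowRD xi (g2 - 1)) cpowR_real//.
  ring.
have mf m : cmeasurable (f m).
  apply: cmeasurableM; first exact: cmeasurable_cst.
  exact: cmeasurable_cbeta_kernel.
have normf m xi :
    normc (f m xi) = normc (A m) * beta_kernel (Re g2 + l m) (Re q) xi.
  by rewrite Normc.normcM normc_cbeta_kernel ReD.
have sf xi : csummable (f ^~ xi).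
  rewrite /csummable; under eq_eseriesr do rewrite normf.
  have [xi01|xi01] := boolP (0 < xi < 1); last first.
    apply: (sA _ 0) => // m; rewrite /beta_kernel (negPf xi01)// mul0r//.
  have [K K0 xiK] := xiB _ xi01.
  pose c := xi `^ (Re g2 - 1) * (1 - xi) `^ (Re q - 1).
  have c0 : 0 <= c by rewrite mulr_ge0 ?powR_ge0.
  apply: (sA _ (c * K)) => [|m|m].
  - exact: mulr_ge0.
  - exact: beta_kernel_ge0.
  rewrite /beta_kernel xi01 -mulrA.
  have -> : Re g2 + l m - 1 = Re g2 - 1 + l m by ring.
  have xi0 : 0 < xi by case/andP: xi01.
  rewrite (@powRD _ xi (Re g2 - 1)) ?(gt_eqF xi0) ?implybT//.
  by rewrite mulrAC ler_wpM2l.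
(* The weight given by the integral of the modulus of the m-th Beta kernel:
   termwise integration. *)
have [Kb Kb0 HKb] := beta_le_cbeta g2 q a2 hg2 q0 ha2.
have foo : (\sum_(0 <= m <oo)
    \int[@lebesgue_measure R]_xi (normc (f m xi))%:E < +oo)%E.
  pose rb m := fine (beta_int (Re g2 + l m) (Re q)).
  have rbE m : beta_int (Re g2 + l m) (Re q) = (rb m)%:E.
    by rewrite /rb beta_intE// ltr_wpDr.
  under eq_eseriesr => m _.
    under eq_integral do rewrite normf EFinM.
    rewrite ge0_integralZl//; last 3 first.
    - by apply/measurable_EFinP; exact: measurable_beta_kernel.
    - by move=> xi _; rewrite lee_fin beta_kernel_ge0.
    - by rewrite lee_fin normc_ge0.
    rewrite -/(beta_int _ _) rbE -EFinM.
    over.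
  apply: (sA _ Kb) => [|m|m]; first exact: ltW.
    by rewrite -lee_fin -rbE beta_int_ge0.
  by rewrite -lee_fin -rbE; exact: HKb.
have [iF eF] := cintegral_series f mf sf foo.
have FE xi : (if xi \in `]0, 1[%classic then W xi else 0) = cseries (f ^~ xi).
  rewrite mem_setE in_itv/=; case: ifPn => [/WE//|xi01].
  rewrite (eq_cseries _ (fun m => 0 * f m xi)); last first.
    by move=> m; rewrite /f /cbeta_kernel (negPf xi01) !mulr0.
  by rewrite cseriesZ// mul0r.
split.
- move=> xi xi01; have [K K0 xiK] := xiB _ xi01.
  apply: (csummable2_le (K / normc kappa) t) hconv.
    by rewrite divr_ge0 ?normc_ge0.
  move=> m n; rewrite -/(w xi) wE tE (Normc.normcM _ (u m n)).
  rewrite (Normc.normcM _ (u m n)) (Normc.normcM kappa) normc_real.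
  rewrite ger0_norm ?powR_ge0// !mulrA ler_wpM2r ?normc_ge0//.
  by rewrite divfK ?gt_eqF.
- apply/cintegrable_mkcond => //.
  apply: eq_cintegrable iF => // xi _; rewrite -FE//.
- rewrite -/(W _) cintegral_mkcond.
  rewrite (eq_cintegral _ _ (fun xi => cseries (f ^~ xi)))//.
  rewrite eF -/kappa.
  have intf m : cintegral setT (f m) = B m * A m.
    have ib := cintegrable_cbeta_kernel _ _ (gl0 m) q0.
    by rewrite (cintegrableZl _ _ (A m) measurableT ib).2 mulrC.
  rewrite (eq_cseries _ _ intf) -cseriesZ; last first.
    rewrite /csummable; under eq_eseriesr do rewrite Normc.normcM mulrC.
    by apply: (sA _ 1) => // m; rewrite ?normc_ge0 ?mul1r.
  apply: eq_cseries => m; rewrite mulrA -cseriesZ//.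
  by apply: eq_cseries => n; rewrite -tE.
Qed.
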